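(* Let $F(p,q,t)=\frac14p^4+u_1(q,t)p^2+u_2(q,t)p+u_3(q,t)$ be a polynomial of degree four in $p$ whose coefficients $u_1,u_2,u_3$ are smooth real functions, periodic in both $q$ and $t$, and which satisfies $$F_t+pF_q-u_qF_p=0,$$ where $u=u_1$. Then there necessarily exists a quadratic integral, namely the energy $H=\frac{p^2}{2}+u$ (that is, $H$ itself satisfies $H_t+pH_q-u_qH_p=0$), and $F$ is a function of $H$.
   Context: Subscripts denote partial derivatives. The Hamiltonian is $H=p^2/2+u(q,t)$ with potential $u$ periodic in $q$ and $t$. A function $F(p,q,t)$ is an integral of motion of the Hamiltonian flow of $H$ if $F_t+pF_q-u_qF_p=0$. For $F$ as in the claim the equation forces $(u_1)_q=u_q$, and since adding a function of $t$ to $u$ does not change the Hamiltonian equations, the convention throughout is $u=u_1$.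
   Formalization: ''F is a function of H'' is proved globally only when u is nonconstant; for constant u it is proved locally, near points where dH is nonzero, because u_1=0, u_2=1, u_3=0 gives F=p^4/4+p, which is not a single function of H=p^2/2. *)

(* Defs.v *)
From Stdlib Require Import Reals.
From Coquelicot Require Import Coquelicot.
Open Scope R_scope.

(* Functions on the extended phase space take their arguments in the order
   p, q, t; functions on the configuration space in the order q, t. *)

Definition smooth (f : R -> R -> R) : Prop :=
  forall (n : nat) (q t : R), ex_diff_n f n q t.

Definition biperiodic (Tq Tt : R) (f : R -> R -> R) : Prop :=
  forall q t : R, f (q + Tq) t = f q t /\ f q (t + Tt) = f q t.

Definition energy (u : R -> R -> R) (p q t : R) : R := p ^ 2 / 2 + u q t.

Definition quartic (u1 u2 u3 : R -> R -> R) (p q t : R) : R :=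
  / 4 * p ^ 4 + u1 q t * p ^ 2 + u2 q t * p + u3 q t.

Definition d_p (F : R -> R -> R -> R) (p q t : R) : R :=
  Derive (fun x => F x q t) p.
Definition d_q (F : R -> R -> R -> R) (p q t : R) : R :=
  Derive (fun x => F p x t) q.
Definition d_t (F : R -> R -> R -> R) (p q t : R) : R :=
  Derive (fun x => F p q x) t.

(* [Derive] is total, so this is meant for differentiable [u] and [F]; it is
   only applied to polynomials in p whose coefficients are smooth. *)
Definition integral_of_motion (u : R -> R -> R) (F : R -> R -> R -> R) : Prop :=
  forall p q t : R,
    d_t F p q t + p * d_q F p q t
      - Derive (fun x => u x t) q * d_p F p q t = 0.

Definition regular_point (H : R -> R -> R -> R) (p q t : R) : Prop :=
  d_p H p q t <> 0 \/ d_q H p q t <> 0 \/ d_t H p q t <> 0.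

Definition function_of (H F : R -> R -> R -> R) : Prop :=
  exists f : R -> R, forall p q t : R, F p q t = f (H p q t).

(* Functional dependence. Near a regular point of [H] the levels of [H] are
   hypersurfaces, so for smooth [F] the function [f] is automatically smooth
   near the value of [H] at that point. *)
Definition locally_function_of (H F : R -> R -> R -> R) : Prop :=
  forall p q t : R, regular_point H p q t ->
  exists f : R -> R,
    locally (p, q, t)
      (fun x : R * R * R =>
         F (fst (fst x)) (snd (fst x)) (snd x)
         = f (H (fst (fst x)) (snd (fst x)) (snd x))).

Definition nonconstant (u : R -> R -> R) : Prop :=
  exists q t q' t' : R, u q t <> u q' t'.

(* A constant potential [u] has the quartic integrals
   p^4/4 + u p^2 + c p + d = H^2 + c p + (d - u^2); for c <> 0 these are
   functions of H on each of p > 0 and p < 0, but not on all of phase space.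
   So a single global function of H exists only for nonconstant potentials, and
   for arbitrary potentials the dependence is local, at regular points of H. *)
Definition depends_on_energy (u : R -> R -> R) (F : R -> R -> R -> R) : Prop :=
  locally_function_of (energy u) F
  /\ (nonconstant u -> function_of (energy u) F).

(* Main.v *)
Require Import Defs.
From Stdlib Require Import Reals Lra Lia Psatz List ZArith Classical ClassicalEpsilon.
From Coquelicot Require Import Coquelicot.
Open Scope R_scope.

(** Write [F = p^4/4 + u p^2 + v p + w]. Comparing powers of [p], [F] is an
    integral exactly when
      [u_t = - v_q],  [v_t = 2 u u_q - w_q],  [w_t = u_q v],
    and everything follows once [v_q = 0] is known: then [u_t = 0], periodicity
    in [q] makes [v] and [w - u^2] constant with [v u_q = 0], and
    [F = H^2 + v p + const] where either [v = 0] or [u] is constant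
    ([benney_steady]).

    The critical points [r] of [F] in [p] are the roots of [p^3 + 2 u p + v]; the
    critical value [R = F(r)] is a Riemann invariant: [R_t + r R_q = 0] with
    [R_q = F_q(r)]. Three mechanisms force these derivatives to vanish.

    Suppose first that there is only one real critical point [s]. Let [R = X + i Y]
    be the critical value at a complex one, [r = - s/2 + i b]; then [Y = - s b^3],
    and [R_t + r R_q = 0] makes the Jacobian of [(X, Y)] equal to [b |R_q|^2] up to
    sign. The form [Y^4 dX], cut off to the part of the region where [v < 0],
    extends by zero to a [C^1] form on the torus, so the integral of its
    differential vanishes and [R_q = 0] ([elliptic_relations]).

    Next, let [s > 0] be a simple critical point that is a local minimum. Along
    the direction [dq/dt = s] the quantity [F_q^2 F_pp] at [s] has derivative
    [6 s F_q^3 / F_pp] ([transport_along_root]). It vanishes when critical points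
    merge, so it can be maximised over the torus without discussing that boundary,
    and at the maximum [F_q = 0] ([quartic_q_zero_positive]). In the elliptic part
    the same argument is run with the extra weight [Y^2], which is locally constant
    there and vanishes on its boundary ([elliptic_quartic_q_zero]). Reversal of time
    and momentum treats [s < 0].

    Consequently [v_q = 0] wherever only one critical point is real, and
    [dv = r du] for the middle critical point [r] where all three are. A last pair
    of maximum arguments, for [(discr v_q)^2] and then for [v_q^2], leaves
    [v_q = 0] everywhere ([dq_v_zero]). *)


(** * Calculus of smooth functions of two variables *)

Definition dq (f : R -> R -> R) (q t : R) : R := Derive (fun x => f x t) q.
Definition dt (f : R -> R -> R) (q t : R) : R := Derive (fun x => f q x) t.

Lemma smooth_dq f : smooth f -> smooth (dq f).
Proof. intros sf n q t. exact (ex_diff_n_deriv_aux1 f n q t (sf (S n) q t)). Qed.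

Lemma smooth_dt f : smooth f -> smooth (dt f).
Proof. intros sf n q t. exact (ex_diff_n_deriv_aux2 f n q t (sf (S n) q t)). Qed.

Lemma smooth_continuity_2d f : smooth f -> forall q t, continuity_2d_pt f q t.
Proof. intros sf q t. exact (proj1 (sf 1%nat q t)). Qed.

Lemma smooth_continuous f : smooth f ->
  forall x : R * R, continuous (fun x : R * R => f (fst x) (snd x)) x.
Proof.
  intros sf [q t]. apply continuity_2d_pt_filterlim, smooth_continuity_2d, sf.
Qed.

Lemma smooth_is_derive_q f : smooth f ->
  forall q t, is_derive (fun x => f x t) q (dq f q t).
Proof. intros sf q t. apply Derive_correct. exact (proj1 (proj2 (sf 1%nat q t))). Qed.

Lemma smooth_is_derive_t f : smooth f ->
  forall q t, is_derive (fun x => f q x) t (dt f q t).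
Proof.
  intros sf q t. apply Derive_correct.
  exact (proj1 (proj2 (proj2 (sf 1%nat q t)))).
Qed.

Lemma smooth_differentiable f : smooth f ->
  forall q t, differentiable_pt_lim f q t (dq f q t) (dt f q t).
Proof.
  intros sf q t. apply filterdiff_differentiable_pt_lim.
  apply (is_derive_filterdiff f q t (dq f) (dt f q t)).
  - apply filter_forall. intros [a b]. apply smooth_is_derive_q, sf.
  - apply smooth_is_derive_t, sf.
  - apply (smooth_continuous (dq f)), smooth_dq, sf.
Qed.

Lemma smooth_is_derive_comp f a b x a' b' : smooth f ->
  is_derive a x a' -> is_derive b x b' ->
  is_derive (fun y => f (a y) (b y)) x
    (dq f (a x) (b x) * a' + dt f (a x) (b x) * b').
Proof.
  intros sf Ha Hb. apply is_derive_Reals.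
  apply derivable_pt_lim_comp_2d; try apply is_derive_Reals; trivial.
  apply smooth_differentiable, sf.
Qed.

Lemma smooth_schwarz f : smooth f -> forall q t, dt (dq f) q t = dq (dt f) q t.
Proof.
  intros sf q t. symmetry. unfold dq, dt. apply Schwarz.
  - exists (mkposreal 1 Rlt_0_1). intros a b _ _.
    repeat split; eexists.
    + apply (smooth_is_derive_q f sf).
    + apply (smooth_is_derive_t f sf).
    + apply (smooth_is_derive_q (dt f) (smooth_dt f sf)).
    + apply (smooth_is_derive_t (dq f) (smooth_dq f sf)).
  - apply (smooth_continuity_2d (dq (dt f))), smooth_dq, smooth_dt, sf.
  - apply (smooth_continuity_2d (dt (dq f))), smooth_dt, smooth_dq, sf.
Qed.

Lemma continuity_2d_scal_reflect c f : smooth f ->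
  forall q t, continuity_2d_pt (fun q t => c * f q (- t)) q t.
Proof.
  intros sf q t. apply continuity_2d_pt_filterlim.
  apply (continuous_mult (fun _ : R * R => c)); [apply continuous_const|].
  apply (continuous_comp_2 (fun z : R * R => fst z) (fun z => - snd z) f).
  - apply continuous_fst.
  - apply (continuous_opp (fun z : R * R => snd z)), continuous_snd.
  - apply (smooth_continuous f sf).
Qed.

Lemma is_derive_scal_reflect_q c f : smooth f ->
  forall q t, is_derive (fun z => c * f z (- t)) q (c * dq f q (- t)).
Proof.
  intros sf q t. apply (is_derive_scal (fun z => f z (- t))), smooth_is_derive_q, sf.
Qed.

Lemma is_derive_scal_reflect_t c f : smooth f ->
  forall q t, is_derive (fun z => c * f q (- z)) t (- c * dt f q (- t)).
Proof.
  intros sf q t.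
  replace (- c * dt f q (- t))
    with (c * (dq f q (- t) * 0 + dt f q (- t) * -1)) by ring.
  apply (is_derive_scal (fun z => f q (- z))).
  apply (smooth_is_derive_comp f (fun _ => q) Ropp); trivial;
    auto_derive; trivial.
Qed.

(** Stated with a factor [c] because differentiating in [t] changes the sign. *)
Lemma smooth_scal_reflect c f : smooth f -> smooth (fun q t => c * f q (- t)).
Proof.
  intros sf n. revert c f sf. induction n as [|n IH]; intros c f sf q t.
  - split; [|exact I]. apply continuity_2d_scal_reflect, sf.
  - split; [|split; [|split; [|split]]].
    + apply continuity_2d_scal_reflect, sf.
    + eexists; apply is_derive_scal_reflect_q, sf.
    + eexists; apply is_derive_scal_reflect_t, sf.
    + apply ex_diff_n_ext_loc with (2 := IH c (dq f) (smooth_dq f sf) q t).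
      exists (mkposreal 1 Rlt_0_1). intros a b _ _. symmetry.
      apply is_derive_unique, is_derive_scal_reflect_q, sf.
    + apply ex_diff_n_ext_loc with (2 := IH (- c) (dt f) (smooth_dt f sf) q t).
      exists (mkposreal 1 Rlt_0_1). intros a b _ _. symmetry.
      apply is_derive_unique, is_derive_scal_reflect_t, sf.
Qed.

Lemma biperiodic_dq Tq Tt f : biperiodic Tq Tt f -> biperiodic Tq Tt (dq f).
Proof.
  intros pf q t. unfold dq. split.
  - transitivity (Derive (fun x => f (x + Tq) t) q).
    + unfold Derive. f_equal. apply Lim_ext. intros h.
      replace (q + h + Tq) with (q + Tq + h) by ring. reflexivity.
    + apply Derive_ext. intros x. apply pf.
  - apply Derive_ext. intros x. apply pf.
Qed.

Lemma biperiodic_dt Tq Tt f : biperiodic Tq Tt f -> biperiodic Tq Tt (dt f).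
Proof.
  intros pf q t. unfold dt. split.
  - apply Derive_ext. intros x. apply pf.
  - transitivity (Derive (fun x => f q (x + Tt)) t).
    + unfold Derive. f_equal. apply Lim_ext. intros h.
      replace (t + h + Tt) with (t + Tt + h) by ring. reflexivity.
    + apply Derive_ext. intros x. apply pf.
Qed.

(** * Continuity of polynomial expressions *)

Lemma continuous_Rplus (U : UniformSpace) (f g : U -> R) x :
  continuous f x -> continuous g x -> continuous (fun y => f y + g y) x.
Proof. apply (continuous_plus (V := R_NormedModule)). Qed.

Lemma continuous_Ropp (U : UniformSpace) (f : U -> R) x :
  continuous f x -> continuous (fun y => - f y) x.
Proof. apply (continuous_opp (V := R_NormedModule)). Qed.

Lemma continuous_Rminus (U : UniformSpace) (f g : U -> R) x :
  continuous f x -> continuous g x -> continuous (fun y => f y - g y) x.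
Proof. apply (continuous_minus (V := R_NormedModule)). Qed.

Lemma continuous_Rmult (U : UniformSpace) (f g : U -> R) x :
  continuous f x -> continuous g x -> continuous (fun y => f y * g y) x.
Proof. apply (continuous_mult (K := R_AbsRing)). Qed.

Lemma continuous_Rpow (U : UniformSpace) (f : U -> R) n x :
  continuous f x -> continuous (fun y => f y ^ n) x.
Proof.
  intros Hf. induction n as [|n IH]; simpl; [apply continuous_const|].
  now apply continuous_Rmult.
Qed.

Lemma continuous_Rdiv (U : UniformSpace) (f g : U -> R) x :
  continuous f x -> continuous g x -> g x <> 0 ->
  continuous (fun y => f y / g y) x.
Proof.
  intros Hf Hg H0. unfold Rdiv. apply continuous_Rmult; trivial.
  apply continuous_comp; trivial. now apply continuous_Rinv.
Qed.

Ltac continuity_step :=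
  lazymatch goal with
  | |- continuous (fun _ => ?c) _ => apply continuous_const
  | |- continuous (fun x => @?f x + @?g x) _ => apply (continuous_Rplus _ f g)
  | |- continuous (fun x => @?f x - @?g x) _ => apply (continuous_Rminus _ f g)
  | |- continuous (fun x => @?f x * @?g x) _ => apply (continuous_Rmult _ f g)
  | |- continuous (fun x => @?f x / @?g x) _ => apply (continuous_Rdiv _ f g)
  | |- continuous (fun x => - @?f x) _ => apply (continuous_Ropp _ f)
  | |- continuous (fun x => @?f x ^ ?n) _ => apply (continuous_Rpow _ f n)
  end.
Ltac continuity_poly := repeat continuity_step; trivial.

(** * Maxima over periodic sets *)

Lemma periodic_representative T : 0 < T -> forall x, exists y, 0 <= y <= T /\
  forall P : R -> Prop, (forall z, P (z + T) <-> P z) -> (P x <-> P y).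
Proof.
  intros hT x.
  assert (Hn : forall (P : R -> Prop), (forall z, P (z + T) <-> P z) ->
            forall (n : nat) z, P (z + INR n * T) <-> P z).
  { intros P HP n. induction n as [|n IH]; intros z.
    - simpl. replace (z + 0 * T) with z by ring. tauto.
    - rewrite S_INR. replace (z + (INR n + 1) * T) with (z + INR n * T + T) by ring.
      rewrite HP. apply IH. }
  assert (Hz : forall (P : R -> Prop), (forall z, P (z + T) <-> P z) ->
            forall (k : Z) z, P (z + IZR k * T) <-> P z).
  { intros P HP k z. destruct (Z_le_dec 0 k) as [h|h].
    - rewrite <- (Z2Nat.id k h), <- INR_IZR_INZ. apply Hn, HP.
    - rewrite <- (Hn P HP (Z.to_nat (- k)) (z + IZR k * T)).
      rewrite INR_IZR_INZ, Z2Nat.id, opp_IZR by lia.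
      replace (z + IZR k * T + - IZR k * T) with z by ring. tauto. }
  destruct (archimed (x / T)) as [h1 h2].
  set (k := up (x / T)) in *.
  assert (hx : x = x / T * T) by (field; lra).
  exists (x + IZR (1 - k) * T). rewrite minus_IZR. split.
  - split; rewrite hx at 1; nra.
  - intros P HP. rewrite <- minus_IZR, Hz by assumption. tauto.
Qed.

Definition in_box (M Tq Tt p q t : R) : Prop :=
  - M <= p <= M /\ 0 <= q <= Tq /\ 0 <= t <= Tt.

(** If no point of [C] were maximal, every point would have a neighbourhood on
    which [f] stays below a value attained elsewhere on [C]; by compactness finitely
    many such values suffice, and the largest one would be smaller than itself. *)
Lemma box_max (C : R -> R -> R -> Prop) (f : R -> R -> R -> R) (M Tq Tt : R) :
  (forall p q t, ~ C p q t -> exists d : posreal, forall p' q' t',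
     Rabs (p' - p) < d -> Rabs (q' - q) < d -> Rabs (t' - t) < d ->
     ~ C p' q' t') ->
  (forall p q t, forall a, f p q t < a -> exists d : posreal, forall p' q' t',
     Rabs (p' - p) < d -> Rabs (q' - q) < d -> Rabs (t' - t) < d ->
     f p' q' t' < a) ->
  (exists p q t, in_box M Tq Tt p q t /\ C p q t) ->
  exists p q t, in_box M Tq Tt p q t /\ C p q t /\
    forall p' q' t', in_box M Tq Tt p' q' t' -> C p' q' t' ->
      f p' q' t' <= f p q t.
Proof.
  intros Hopen Hcont [p0 [q0 [t0 [Hb0 HC0]]]].
  apply NNPP. intros Hno.
  pose (dominated (d : posreal) (y x : R * (R * (R * unit))) :=
    let '(yp, (yq, (yt, _))) := y in let '(p, (q, (t, _))) := x in
    in_box M Tq Tt yp yq yt /\ C yp yq yt /\ forall p' q' t',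
     Rabs (p' - p) < d -> Rabs (q' - q) < d -> Rabs (t' - t) < d ->
     in_box M Tq Tt p' q' t' -> C p' q' t' -> f p' q' t' < f yp yq yt).
  assert (Hloc : forall x, exists dy : posreal * (R * (R * (R * unit))),
             let '(p, (q, (t, _))) := x in in_box M Tq Tt p q t ->
             dominated (fst dy) (snd dy) x).
  { intros [p [q [t []]]].
    destruct (classic (in_box M Tq Tt p q t)) as [hb|hb].
    2: { exists (mkposreal 1 Rlt_0_1, (0, (0, (0, tt)))). tauto. }
    destruct (classic (C p q t)) as [hC|hC].
    - assert (Hy : exists yp yq yt, in_box M Tq Tt yp yq yt /\ C yp yq yt /\
                f p q t < f yp yq yt).
      { apply NNPP. intros Hn. apply Hno. exists p, q, t. split; [|split]; trivial.
        intros p' q' t' hb' hC'. apply Rnot_lt_le. intros hlt. apply Hn.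
        exists p', q', t'. auto. }
      destruct Hy as [yp [yq [yt [hby [hCy hlt]]]]].
      destruct (Hcont p q t _ hlt) as [d Hd].
      exists (d, (yp, (yq, (yt, tt)))). simpl. auto.
    - destruct (Hopen p q t hC) as [d Hd].
      exists (d, (p0, (q0, (t0, tt)))). simpl. intros _. split; [|split]; trivial.
      intros p' q' t' h1 h2 h3 _ h4. exfalso. exact (Hd p' q' t' h1 h2 h3 h4). }
  destruct (choice _ Hloc) as [sel Hsel].
  apply (Compactness.compactness_list 3 (- M, (0, (0, tt))) (M, (Tq, (Tt, tt)))
           (fun x => fst (sel x))).
  intros [l Hl].
  (* Over a finite subcover one point dominates all the others. *)
  assert (Hdom : forall l', exists yp yq yt, in_box M Tq Tt yp yq yt /\
    C yp yq yt /\ forall x, In x l' -> let '(p, (q, (t, _))) := x in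
    in_box M Tq Tt p q t -> forall p' q' t',
     Rabs (p' - p) < fst (sel x) -> Rabs (q' - q) < fst (sel x) ->
     Rabs (t' - t) < fst (sel x) ->
     in_box M Tq Tt p' q' t' -> C p' q' t' -> f p' q' t' < f yp yq yt).
  { induction l' as [|x l' IH].
    - exists p0, q0, t0. split; [|split]; trivial. intros x [].
    - destruct IH as [yp [yq [yt [hby [hCy IH]]]]].
      destruct x as [p [q [t u]]]. specialize (Hsel (p, (q, (t, u)))).
      simpl in Hsel.
      destruct (classic (in_box M Tq Tt p q t)) as [hb|hb].
      + specialize (Hsel hb).
        destruct (sel (p, (q, (t, u)))) as [d [zp [zq [zt uz]]]] eqn:Es.
        simpl in Hsel. destruct Hsel as [hbz [hCz Hz]].
        destruct (Rle_or_lt (f zp zq zt) (f yp yq yt)) as [hle|hlt].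
        * exists yp, yq, yt. split; [|split]; trivial. intros x [<-|Hx].
          -- rewrite Es. simpl. intros _ p' q' t' h1 h2 h3 h4 h5.
             apply Rlt_le_trans with (2 := hle). auto.
          -- exact (IH x Hx).
        * exists zp, zq, zt. split; [|split]; trivial. intros x [<-|Hx].
          -- rewrite Es. simpl. auto.
          -- specialize (IH x Hx). destruct x as [xp [xq [xt xu]]].
             intros hbx p' q' t' h1 h2 h3 h4 h5.
             apply Rlt_trans with (2 := hlt). auto.
      + exists yp, yq, yt. split; [|split]; trivial. intros x [<-|Hx].
        * intros hb'. contradiction.
        * exact (IH x Hx). }
  destruct (Hdom l) as [yp [yq [yt [hby [hCy Hy]]]]].
  destruct (Hl (yp, (yq, (yt, tt)))) as [[p [q [t u]]] [Hin [Hb Hc]]].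
  { unfold in_box in hby. simpl. tauto. }
  specialize (Hy _ Hin). simpl in Hy, Hb, Hc.
  apply (Rlt_irrefl (f yp yq yt)). apply Hy; unfold in_box in *; tauto.
Qed.

Lemma continuous_open_box (g : R -> R -> R -> R) (P : R -> Prop) p q t :
  continuous (fun x : R * R * R => g (fst (fst x)) (snd (fst x)) (snd x)) (p, q, t) ->
  open P -> P (g p q t) ->
  exists d : posreal, forall p' q' t',
     Rabs (p' - p) < d -> Rabs (q' - q) < d -> Rabs (t' - t) < d -> P (g p' q' t').
Proof.
  intros Hc HP Hx.
  destruct (Hc P (HP _ Hx)) as [d Hd].
  exists d. intros p' q' t' h1 h2 h3. apply (Hd (p', q', t')).
  repeat split; simpl; assumption.
Qed.

(** Constraints of this form define a closed set, and periodicity replaces the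
    torus by one box. *)
Lemma periodic_constrained_max (h k l f : R -> R -> R -> R) (M Tq Tt : R) :
  0 < Tq -> 0 < Tt ->
  (forall g, In g (h :: k :: l :: f :: nil) ->
     (forall p q t, g p (q + Tq) t = g p q t /\ g p q (t + Tt) = g p q t) /\
     (forall x : R * R * R,
        continuous (fun x => g (fst (fst x)) (snd (fst x)) (snd x)) x)) ->
  (forall p q t, h p q t = 0 -> 0 <= k p q t -> 0 <= l p q t -> - M <= p <= M) ->
  (exists p q t, h p q t = 0 /\ 0 <= k p q t /\ 0 <= l p q t) ->
  exists p q t, (h p q t = 0 /\ 0 <= k p q t /\ 0 <= l p q t) /\
    forall p' q' t', h p' q' t' = 0 -> 0 <= k p' q' t' -> 0 <= l p' q' t' ->
      f p' q' t' <= f p q t.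
Proof.
  intros hTq hTt Hg HM [p0 [q0 [t0 H0]]].
  assert (Hper : forall p q t, exists q' t', 0 <= q' <= Tq /\ 0 <= t' <= Tt /\
     h p q' t' = h p q t /\ k p q' t' = k p q t /\ l p q' t' = l p q t /\
     f p q' t' = f p q t).
  { intros p q t.
    destruct (periodic_representative Tq hTq q) as [q' [hq' Hq']].
    destruct (periodic_representative Tt hTt t) as [t' [ht' Ht']].
    exists q', t'.
    assert (He : forall g, In g (h :: k :: l :: f :: nil) -> g p q' t' = g p q t).
    { intros g Hin. destruct (Hg g Hin) as [Hp _].
      transitivity (g p q' t).
      - refine (proj1 (Ht' (fun z => g p q' z = g p q' t) _) eq_refl).
        intros z. rewrite (proj2 (Hp p q' z)). tauto.
      - refine (proj1 (Hq' (fun z => g p z t = g p q t) _) eq_refl).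
        intros z. rewrite (proj1 (Hp p z t)). tauto. }
    simpl in He. repeat split; try tauto; apply He; auto. }
  destruct (box_max (fun p q t => h p q t = 0 /\ 0 <= k p q t /\ 0 <= l p q t)
              f M Tq Tt) as [p [q [t [_ [HC Hmax]]]]].
  - intros p q t HC.
    assert (Hc : forall g, In g (h :: k :: l :: f :: nil) -> forall P, open P ->
      P (g p q t) -> exists d : posreal, forall p' q' t', Rabs (p' - p) < d ->
      Rabs (q' - q) < d -> Rabs (t' - t) < d -> P (g p' q' t')).
    { intros g Hin P HP Hx. apply (continuous_open_box g P); trivial.
      apply (proj2 (Hg g Hin)). }
    simpl in Hc.
    destruct (Req_dec (h p q t) 0) as [h0|h0].
    + destruct (Rle_dec 0 (k p q t)) as [k0|k0].
      * destruct (Rle_dec 0 (l p q t)) as [l0|l0]; [tauto|].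
        destruct (Hc l ltac:(auto) _ (open_lt 0) ltac:(lra)) as [d Hd].
        exists d. intros p' q' t' h1 h2 h3. specialize (Hd p' q' t' h1 h2 h3). lra.
      * destruct (Hc k ltac:(auto) _ (open_lt 0) ltac:(lra)) as [d Hd].
        exists d. intros p' q' t' h1 h2 h3. specialize (Hd p' q' t' h1 h2 h3). lra.
    + destruct (Hc h ltac:(auto) _ (open_neq 0) h0) as [d Hd].
      exists d. intros p' q' t' h1 h2 h3. specialize (Hd p' q' t' h1 h2 h3). tauto.
  - intros p q t a Ha. apply (continuous_open_box f (fun x => x < a)); trivial.
    + apply (proj2 (Hg f ltac:(simpl; auto))).
    + apply open_lt.
  - destruct (Hper p0 q0 t0) as [q' [t' [hq [ht [e1 [e2 [e3 e4]]]]]]].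
    exists p0, q', t'. unfold in_box. rewrite e1, e2, e3.
    specialize (HM p0 q0 t0). intuition.
  - exists p, q, t. split; [exact HC|]. intros p' q' t' h1 h2 h3.
    destruct (Hper p' q' t') as [q'' [t'' [hq [ht [e1 [e2 [e3 e4]]]]]]].
    rewrite <- e4. apply Hmax; [|rewrite e1, e2, e3; auto].
    specialize (HM p' q' t'). unfold in_box. intuition.
Qed.

(** * First-order conditions at a maximum *)

Lemma is_derive_at_max (f : R -> R) x l :
  is_derive f x l -> locally x (fun y => f y <= f x) -> l = 0.
Proof.
  intros Hf [d Hd].
  assert (Hpr : derivable_pt_lim f x l) by now apply is_derive_Reals.
  pose (pr := exist (fun l => derivable_pt_abs f x l) l Hpr).
  change (derive_pt f x pr = 0).
  apply (deriv_maximum f (x - d) (x + d) x); try (pose proof (cond_pos d); lra).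
  intros y h1 h2. apply Hd. apply Rabs_lt_between'. lra.
Qed.

(** The difference of two cubics, each at its own root. At a simple root the
    quotient is close to the derivative of the cubic, so this controls how the root
    depends on the coefficients. *)
Lemma cubic_root_increment u v p u' v' p' :
  p ^ 3 + 2 * u * p + v = 0 -> p' ^ 3 + 2 * u' * p' + v' = 0 ->
  (p' - p) * (p' ^ 2 + p' * p + p ^ 2 + 2 * u')
    = - (2 * p * (u' - u) + (v' - v)).
Proof. intros. nra. Qed.

(** Where [f] vanishes, the product rule asks only for continuity of [g]. *)
Lemma is_derive_mult_zero (f g : R -> R) x l :
  is_derive f x l -> f x = 0 -> continuous g x ->
  is_derive (fun y => f y * g y) x (l * g x).
Proof.
  intros [_ Hf] Hx Hg. split; [apply is_linear_scal_l|].
  intros z Hz. apply (is_filter_lim_locally_unique x z) in Hz. subst z.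
  specialize (Hf x (fun P HP => HP)).
  intros eps.
  pose proof (Rabs_pos (g x)) as Hgx. pose proof (Rabs_pos l) as Hl.
  assert (e1 : 0 < eps / 2 / (Rabs (g x) + 1)).
  { apply Rdiv_lt_0_compat; [|lra]. pose proof (cond_pos eps). lra. }
  assert (e2 : 0 < Rmin 1 (eps / 2 / (Rabs l + 1))).
  { apply Rmin_pos; [lra|]. apply Rdiv_lt_0_compat; [|lra].
    pose proof (cond_pos eps). lra. }
  generalize (filter_and _ _ (Hf (mkposreal _ e1))
                (Hg _ (locally_ball (g x) (mkposreal _ e2)))).
  apply filter_imp. intros y [H1 H2].
  unfold ball in H2. simpl in H2. unfold AbsRing_ball, abs, minus, plus, opp in H2.
  simpl in H2.
  unfold norm, minus, plus, opp, scal in *. simpl in *.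
  unfold abs, mult in *. simpl in *.
  rewrite Hx in *.
  replace (f y * g y + - (0 * g x) + - ((y + - x) * (l * g x)))
    with ((f y + - 0 + - ((y + - x) * l)) * g y + (y + - x) * (l * (g y + - g x)))
    by ring.
  pose proof (Rmin_l 1 (eps / 2 / (Rabs l + 1))).
  pose proof (Rmin_r 1 (eps / 2 / (Rabs l + 1))).
  assert (Hgy : Rabs (g y) <= Rabs (g x) + 1).
  { replace (g y) with (g x + (g y + - g x)) by ring.
    eapply Rle_trans; [apply Rabs_triang|]. lra. }
  eapply Rle_trans; [apply Rabs_triang|]. rewrite !Rabs_mult.
  set (A := Rabs (f y + - 0 + _)) in *. set (D := Rabs (y + - x)) in *.
  set (E := Rabs (g y + - g x)) in *.
  assert (0 <= A) by apply Rabs_pos. assert (0 <= D) by apply Rabs_pos.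
  assert (0 <= E) by apply Rabs_pos. pose proof (Rabs_pos (g y)).
  assert (B1 : A * Rabs (g y) <= eps / 2 * D).
  { apply Rle_trans with (eps / 2 / (Rabs (g x) + 1) * D * (Rabs (g x) + 1)).
    - apply Rmult_le_compat; trivial.
    - right. field. lra. }
  assert (B2 : D * (Rabs l * E) <= eps / 2 * D).
  { rewrite Rmult_comm. apply Rmult_le_compat_r; trivial.
    apply Rle_trans with ((Rabs l + 1) * (eps / 2 / (Rabs l + 1))).
    - apply Rmult_le_compat; lra.
    - right. field. lra. }
  lra.
Qed.

Lemma is_derive_continuous (f : R -> R) x l : is_derive f x l -> continuous f x.
Proof. intros H. apply (ex_derive_continuous f x). now exists l. Qed.

Lemma is_derive_cubic_root (a b r : R -> R) x a' b' :
  is_derive a x a' -> is_derive b x b' -> continuous r x ->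
  locally x (fun y => r y ^ 3 + 2 * a y * r y + b y = 0) ->
  3 * r x ^ 2 + 2 * a x <> 0 ->
  is_derive r x (- (2 * r x * a' + b') / (3 * r x ^ 2 + 2 * a x)).
Proof.
  intros Ha Hb Hr Hroot HJ.
  pose (Q y := r y * r y + r y * r x + r x * r x + 2 * a y).
  pose (N y := - (2 * r x * (a y - a x) + (b y - b x))).
  assert (HQx : Q x = 3 * r x ^ 2 + 2 * a x) by (unfold Q; ring).
  assert (HQ : continuous Q x).
  { unfold Q.
    pose proof (is_derive_continuous a x a' Ha). continuity_poly. }
  assert (HN : is_derive N x (- (2 * r x * a' + b'))).
  { unfold N. auto_derive.
    - repeat split; eexists; eassumption.
    - change (Derive (fun x0 => a x0) x) with (Derive a x).
      change (Derive (fun x0 => b x0) x) with (Derive b x).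
      rewrite (is_derive_unique _ _ _ Ha), (is_derive_unique _ _ _ Hb). ring. }
  assert (HG : continuous (fun y => / Q y) x).
  { apply continuous_comp; [exact HQ|]. apply continuous_Rinv. now rewrite HQx. }
  assert (Hd := is_derive_mult_zero N (fun y => / Q y) x _ HN ltac:(unfold N; ring) HG).
  assert (Hd' := is_derive_plus (fun _ => r x) _ x _ _ (is_derive_const (r x) x) Hd).
  apply is_derive_ext_loc with (f := fun y => plus (r x) (N y * / Q y)).
  - assert (HQ0 : locally x (fun y => Q y <> 0)).
    { apply (HQ (fun z => z <> 0)). apply open_neq. now rewrite HQx. }
    generalize (filter_and _ _ HQ0 Hroot). apply filter_imp. intros y [h1 h2].
    pose proof (cubic_root_increment (a x) (b x) (r x) (a y) (b y) (r y)
                  (locally_singleton _ _ Hroot) h2) as Hi.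
    fold (N y) in Hi. unfold plus; simpl. rewrite <- Hi.
    replace (r y ^ 2 + r y * r x + r x ^ 2 + 2 * a y) with (Q y) by (unfold Q; ring).
    field. exact h1.
  - replace (- (2 * r x * a' + b') / (3 * r x ^ 2 + 2 * a x))
      with (plus zero (- (2 * r x * a' + b') * / Q x)); [exact Hd'|].
    rewrite HQx. unfold plus, zero; simpl. unfold Rdiv. ring.
Qed.

Lemma cubic_continuity u v : continuity (fun p => p ^ 3 + 2 * u * p + v).
Proof. reg. Qed.

(** A simple root follows the coefficients: existence is the intermediate value
    theorem on a small interval around [s], where the quotient of
    [cubic_root_increment] stays positive. *)
Lemma cubic_root_branch (a b : R -> R) x s a' b' :
  is_derive a x a' -> is_derive b x b' ->
  s ^ 3 + 2 * a x * s + b x = 0 -> 0 < 3 * s ^ 2 + 2 * a x ->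
  exists r : R -> R, r x = s /\
    is_derive r x (- (2 * s * a' + b') / (3 * s ^ 2 + 2 * a x)) /\
    locally x (fun y => r y ^ 3 + 2 * a y * r y + b y = 0).
Proof.
  intros Ha Hb Hs HJ. set (J := 3 * s ^ 2 + 2 * a x) in *.
  pose proof (Rabs_pos s) as Hsp.
  pose (d := Rmin 1 (J / (4 * (1 + 3 * Rabs s)))).
  assert (Hd : 0 < d).
  { apply Rmin_pos; [lra|]. apply Rdiv_lt_0_compat; lra. }
  assert (Hd1 : d <= 1) by apply Rmin_l.
  assert (Hd2 : d * (1 + 3 * Rabs s) <= J / 4).
  { apply Rle_trans with (J / (4 * (1 + 3 * Rabs s)) * (1 + 3 * Rabs s)).
    - apply Rmult_le_compat_r; [lra|]. apply Rmin_r.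
    - right. field. lra. }
  pose (N y := 2 * s * (a y - a x) + (b y - b x)).
  assert (Hac := is_derive_continuous a x a' Ha).
  assert (Hbc := is_derive_continuous b x b' Hb).
  assert (HN : forall e, 0 < e -> locally x (fun y => Rabs (N y) < e)).
  { intros e He.
    assert (Hc : continuous N x).
    { unfold N.
      continuity_poly. }
    generalize (Hc _ (locally_ball (N x) (mkposreal e He))).
    unfold filtermap. apply filter_imp. intros y Hy. unfold ball in Hy. simpl in Hy.
    unfold AbsRing_ball, abs, minus, plus, opp in Hy. simpl in Hy.
    replace (N y) with (N y + - N x) by (unfold N; ring). exact Hy. }
  assert (HA : locally x (fun y => Rabs (a y - a x) < J / 8)).
  { apply (Hac _ (locally_ball (a x) (mkposreal (J / 8) ltac:(lra)))). }
  assert (HQ : forall y, Rabs (a y - a x) < J / 8 -> forall p, Rabs (p - s) <= d ->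
            J / 2 <= p ^ 2 + p * s + s ^ 2 + 2 * a y).
  { intros y Hy p Hp.
    assert (H1 : Rabs ((p - s) * (p + 2 * s)) <= d * (1 + 3 * Rabs s)).
    { rewrite Rabs_mult. apply Rmult_le_compat; try apply Rabs_pos; trivial.
      replace (p + 2 * s) with ((p - s) + 3 * s) by ring.
      eapply Rle_trans; [apply Rabs_triang|].
      rewrite (Rabs_mult 3 s), (Rabs_right 3) by lra. lra. }
    apply Rabs_le_between in H1. apply Rabs_lt_between in Hy.
    replace (p ^ 2 + p * s + s ^ 2 + 2 * a y)
      with (J + (p - s) * (p + 2 * s) + 2 * (a y - a x)) by (unfold J; ring).
    lra. }
  assert (Hex : forall y, exists p, Rabs (a y - a x) < J / 8 ->
            Rabs (N y) < d * (J / 2) ->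
            Rabs (p - s) <= d /\ p ^ 3 + 2 * a y * p + b y = 0).
  { intros y.
    destruct (Rlt_dec (Rabs (a y - a x)) (J / 8)) as [h1|h1]; [|exists 0; tauto].
    destruct (Rlt_dec (Rabs (N y)) (d * (J / 2))) as [h2|h2]; [|exists 0; tauto].
    assert (Hc : forall p, p ^ 3 + 2 * a y * p + b y =
              N y + (p - s) * (p ^ 2 + p * s + s ^ 2 + 2 * a y)).
    { intros p. unfold N. replace (b y) with (b y + (s ^ 3 + 2 * a x * s + b x) - b x - s ^ 3 - 2 * a x * s) at 1 by ring.
      rewrite Hs. ring. }
    pose proof (HQ y h1 (s + d)) as Q1. pose proof (HQ y h1 (s - d)) as Q2.
    replace (s + d - s) with d in Q1 by ring.
    replace (s - d - s) with (- d) in Q2 by ring.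
    rewrite Rabs_Ropp in Q2. rewrite Rabs_right in Q1, Q2 by lra.
    specialize (Q1 (Rle_refl _)). specialize (Q2 (Rle_refl _)).
    apply Rabs_lt_between in h2.
    destruct (IVT (fun p => p ^ 3 + 2 * a y * p + b y) (s - d) (s + d)) as [p [Hp Hp0]].
    - apply cubic_continuity.
    - lra.
    - rewrite Hc. nra.
    - rewrite Hc. nra.
    - exists p. intros _ _. split; [|exact Hp0]. apply Rabs_le_between'. exact Hp. }
  destruct (choice _ Hex) as [r0 Hr0].
  pose (r y := if Req_EM_T y x then s else r0 y).
  assert (Hrx : r x = s) by (unfold r; destruct (Req_EM_T x x); lra).
  assert (Hr : locally x (fun y => Rabs (a y - a x) < J / 8 /\ Rabs (r y - s) <= d /\
            r y ^ 3 + 2 * a y * r y + b y = 0)).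
  { generalize (filter_and _ _ HA (HN (d * (J / 2)) ltac:(nra))).
    apply filter_imp. intros y [h1 h2]. split; [exact h1|].
    unfold r. destruct (Req_EM_T y x) as [->|_].
    - rewrite Rminus_diag, Rabs_R0. split; [lra|exact Hs].
    - apply Hr0; assumption. }
  assert (Hroot : locally x (fun y => r y ^ 3 + 2 * a y * r y + b y = 0)).
  { revert Hr. apply filter_imp. tauto. }
  exists r. split; [exact Hrx|]. split; [|exact Hroot].
  rewrite <- Hrx. unfold J. rewrite <- Hrx.
  apply (is_derive_cubic_root a b r x a' b'); trivial.
  - intros P [e He]. unfold filtermap.
    generalize (filter_and _ _ Hr (HN (J / 2 * e) ltac:(pose proof (cond_pos e); nra))).
    apply filter_imp. intros y [[h1 [h2 h3]] h4]. apply He.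
    unfold ball. simpl. unfold AbsRing_ball, abs, minus, plus, opp. simpl.
    rewrite Hrx. change (Rabs (r y - s) < e).
    pose proof (HQ y h1 _ h2) as Hq.
    pose proof (cubic_root_increment _ _ _ _ _ _ Hs h3) as Hi.
    fold (N y) in Hi.
    assert (Hi' : Rabs (r y - s) * Rabs (r y ^ 2 + r y * s + s ^ 2 + 2 * a y) = Rabs (N y)).
    { rewrite <- Rabs_mult, Hi. apply Rabs_Ropp. }
    rewrite (Rabs_right (r y ^ 2 + _ + _ + _)) in Hi' by lra.
    pose proof (Rabs_pos (r y - s)). nra.
  - rewrite Hrx. fold J. lra.
Qed.

(** * The positive root of a depressed cubic with negative constant term *)

Definition positive_root (u v : R) : R :=
  epsilon (inhabits 0) (fun s => 0 < s /\ s ^ 3 + 2 * u * s + v = 0).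

Lemma positive_root_spec u v : v < 0 ->
  0 < positive_root u v /\
  positive_root u v ^ 3 + 2 * u * positive_root u v + v = 0.
Proof.
  intros hv.
  apply (epsilon_spec (inhabits 0) (fun s => 0 < s /\ s ^ 3 + 2 * u * s + v = 0)).
  pose (M := 1 + 2 * Rabs u + Rabs v).
  pose proof (Rabs_pos u). pose proof (Rabs_pos v).
  pose proof (Rle_abs u). pose proof (Rle_abs (- u)). rewrite Rabs_Ropp in *.
  pose proof (Rle_abs (- v)). rewrite Rabs_Ropp in *.
  assert (HM : 1 <= M) by (unfold M; lra).
  destruct (IVT (fun p => p ^ 3 + 2 * u * p + v) 0 M) as [s [Hs Hs0]].
  - apply cubic_continuity.
  - lra.
  - simpl. lra.
  - assert (1 + Rabs v <= M ^ 2 + 2 * u).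
    { assert (M <= M ^ 2) by nra. unfold M in *. lra. }
    nra.
  - exists s. split; [|exact Hs0]. destruct (Rle_lt_or_eq_dec 0 s (proj1 Hs)); trivial.
    subst s. simpl in Hs0. lra.
Qed.

Lemma positive_root_unique u v s s' : v < 0 -> 0 < s -> 0 < s' ->
  s ^ 3 + 2 * u * s + v = 0 -> s' ^ 3 + 2 * u * s' + v = 0 -> s' = s.
Proof.
  intros hv hs hs' e e'.
  pose proof (cubic_root_increment u v s u v s' e e') as Hi.
  assert (0 < (s' ^ 2 + 2 * u) * s') by nra.
  assert (0 < s' ^ 2 + 2 * u) by nra.
  replace (- (2 * s * (u - u) + (v - v))) with 0 in Hi by ring.
  destruct (Rmult_integral _ _ Hi); nra.
Qed.

Lemma positive_root_simple u v s : v < 0 -> 0 < s ->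
  s ^ 3 + 2 * u * s + v = 0 -> 0 < 3 * s ^ 2 + 2 * u.
Proof.
  intros hv hs e.
  assert (0 < (s ^ 2 + 2 * u) * s) by nra.
  assert (0 < s ^ 2 + 2 * u) by nra. nra.
Qed.

Lemma cubic_root_bound u v s : 0 <= s -> s ^ 3 + 2 * u * s + v = 0 ->
  s <= 1 + 2 * Rabs u + Rabs v.
Proof.
  intros hs e.
  pose proof (Rabs_pos u). pose proof (Rabs_pos v).
  pose proof (Rle_abs (- u)). pose proof (Rle_abs (- v)).
  rewrite Rabs_Ropp in *.
  apply Rnot_lt_le. intros h.
  assert (s <= s ^ 2) by nra.
  assert (1 + Rabs v < s ^ 2 + 2 * u) by lra. nra.
Qed.

Lemma positive_root_continuous u v : v < 0 ->
  continuous (fun x : R * R => positive_root (fst x) (snd x)) (u, v).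
Proof.
  intros hv.
  destruct (positive_root_spec u v hv) as [hs es].
  set (s := positive_root u v) in *.
  intros P [e He]. simpl in He. fold s in He. pose proof (cond_pos e) as he.
  assert (hd : 0 < Rmin (- v) (s ^ 2 * e / (2 * s + 1))).
  { apply Rmin_pos; [lra|]. apply Rdiv_lt_0_compat; [|lra].
    apply Rmult_lt_0_compat; [apply pow_lt|]; lra. }
  exists (mkposreal _ hd). intros [u' v'] [h1 h2]. simpl in h1, h2.
  unfold ball in h1, h2; simpl in h1, h2.
  unfold AbsRing_ball, abs, minus, plus, opp in h1, h2; simpl in h1, h2.
  change (Rabs (u' - u) < Rmin (- v) (s ^ 2 * e / (2 * s + 1))) in h1.
  change (Rabs (v' - v) < Rmin (- v) (s ^ 2 * e / (2 * s + 1))) in h2.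
  pose proof (Rmin_l (- v) (s ^ 2 * e / (2 * s + 1))).
  pose proof (Rmin_r (- v) (s ^ 2 * e / (2 * s + 1))) as hm.
  assert (hv' : v' < 0) by (pose proof (Rle_abs (v' - v)); lra).
  destruct (positive_root_spec u' v' hv') as [hs' es'].
  set (s' := positive_root u' v') in *.
  apply He. simpl. fold s'.
  unfold ball; simpl; unfold AbsRing_ball, abs, minus, plus, opp; simpl.
  change (Rabs (s' - s) < e).
  pose proof (cubic_root_increment u v s u' v' s' es es') as Hi.
  assert (hq : s ^ 2 <= s' ^ 2 + s' * s + s ^ 2 + 2 * u').
  { assert (0 < (s' ^ 2 + 2 * u') * s') by nra.
    assert (0 < s' ^ 2 + 2 * u') by nra. nra. }
  assert (Hi' : Rabs (s' - s) * (s' ^ 2 + s' * s + s ^ 2 + 2 * u')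
                <= 2 * s * Rabs (u' - u) + Rabs (v' - v)).
  { rewrite <- (Rabs_right (s' ^ 2 + s' * s + s ^ 2 + 2 * u')) at 1
      by (pose proof (pow2_ge_0 s); lra).
    rewrite <- Rabs_mult, Hi, Rabs_Ropp.
    eapply Rle_trans; [apply Rabs_triang|].
    rewrite (Rabs_mult (2 * s)), (Rabs_right (2 * s)) by lra. lra. }
  assert (Hb : 2 * s * Rabs (u' - u) + Rabs (v' - v) < s ^ 2 * e).
  { apply Rlt_le_trans with ((2 * s + 1) * (s ^ 2 * e / (2 * s + 1))).
    - assert (2 * s * Rabs (u' - u) <= 2 * s * (s ^ 2 * e / (2 * s + 1)))
        by (apply Rmult_le_compat_l; lra). lra.
    - right. field. lra. }
  pose proof (Rabs_pos (s' - s)).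
  assert (0 < s ^ 2) by (apply pow_lt; lra).
  apply Rmult_lt_reg_l with (s ^ 2); [lra|]. nra.
Qed.

Lemma is_derive_positive_root (a b : R -> R) x a' b' :
  is_derive a x a' -> is_derive b x b' -> b x < 0 ->
  is_derive (fun y => positive_root (a y) (b y)) x
    (- (2 * positive_root (a x) (b x) * a' + b')
       / (3 * positive_root (a x) (b x) ^ 2 + 2 * a x)).
Proof.
  intros Ha Hb hb.
  pose proof (is_derive_continuous _ _ _ Ha) as Hac.
  pose proof (is_derive_continuous _ _ _ Hb) as Hbc.
  destruct (positive_root_spec (a x) (b x) hb) as [hs es].
  apply (is_derive_cubic_root a b (fun y => positive_root (a y) (b y)) x a' b');
    trivial.
  - apply (continuous_comp_2 a b positive_root); trivial.
    now apply positive_root_continuous.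
  - generalize (Hbc _ (open_lt 0 (b x) hb)). unfold filtermap.
    apply filter_imp. intros y hy. now apply positive_root_spec.
  - pose proof (positive_root_simple _ _ _ hb hs es). lra.
Qed.

(** * The cut-off functions *)

(* Retypes in [R] an equality stated in the normed module structure of [R], as
   [ring], [field] and [lra] require. *)
Ltac eqR := match goal with |- @eq _ ?a ?b => change (@eq R a b) end.

Lemma is_derive_pos_part_pow6 x :
  is_derive (fun y => Rmax 0 y ^ 6) x (6 * Rmax 0 x ^ 5).
Proof.
  destruct (Rtotal_order x 0) as [h|[->|h]].
  - rewrite (Rmax_left 0 x) by lra.
    apply is_derive_ext_loc with (f := fun _ => 0).
    + generalize (open_lt 0 x h). apply filter_imp. intros y hy.
      rewrite Rmax_left by lra. eqR. ring.
    + auto_derive; trivial. ring.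
  - apply is_derive_ext with (f := fun y => y * Rmax 0 y ^ 5).
    + intros y. eqR. destruct (Rle_dec 0 y).
      * rewrite Rmax_right by lra. ring.
      * rewrite Rmax_left by lra. ring.
    + replace (6 * Rmax 0 0 ^ 5) with (1 * Rmax 0 0 ^ 5)
        by (rewrite Rmax_left by lra; ring).
      apply (is_derive_mult_zero (fun y => y) (fun y => Rmax 0 y ^ 5)); trivial.
      * auto_derive; trivial.
      * apply continuous_Rpow. apply continuity_pt_filterlim.
        intros e he. exists e. split; [lra|]. intros y [_ hy].
        simpl in *. unfold R_dist in *. unfold Rmax in *.
        destruct (Rle_dec 0 y), (Rle_dec 0 0); try lra;
        rewrite Rminus_diag, Rabs_R0; lra.
  - rewrite (Rmax_right 0 x) by lra.
    apply is_derive_ext_loc with (f := fun y => y ^ 6).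
    + generalize (open_gt 0 x h). apply filter_imp. intros y hy.
      rewrite Rmax_right by lra. reflexivity.
    + auto_derive; trivial. ring.
Qed.

Lemma continuous_pos_part x : continuous (fun y => Rmax 0 y) x.
Proof.
  apply continuous_ext with (f := fun y => (y + Rabs y) / 2).
  - intros y. unfold Rmax. destruct (Rle_dec 0 y).
    + rewrite Rabs_right; lra.
    + rewrite Rabs_left; lra.
  - continuity_poly; try lra; [apply continuous_id|apply continuous_Rabs].
Qed.

(** If [s] is a root of [p^3 + 2 u p + v] and [-s/2 +- i b] are the other two, this
    is [b^2]. *)
Definition beta (u s : R) : R := 2 * u + 3 / 4 * s ^ 2.

Lemma is_derive_beta (a s : R -> R) x a' s' :
  is_derive a x a' -> is_derive s x s' ->
  is_derive (fun y => beta (a y) (s y)) x (2 * a' + 3 / 2 * s x * s').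
Proof.
  intros Ha Hs. unfold beta. auto_derive.
  - repeat split; eexists; eassumption.
  - change (Derive (fun y => a y) x) with (Derive a x).
    change (Derive (fun y => s y) x) with (Derive s x).
    rewrite (is_derive_unique _ _ _ Ha), (is_derive_unique _ _ _ Hs). eqR. field.
Qed.

(** The functions [s^k Y^4] with [k = n - 4] and [Y = - s b^3], restricted to
    [v < 0] and one real root. The power makes both the passage through
    [beta = 0] and the one through [v = 0] continuously differentiable. *)
Definition cutoff (n : nat) (u v : R) : R :=
  let s := positive_root u v in
  if Rlt_dec v 0 then s ^ n * Rmax 0 (beta u s) ^ 6 else 0.

Definition cutoff_u (n : nat) (u v : R) : R :=
  let s := positive_root u v in
  let J := 3 * s ^ 2 + 2 * u in
  let B := Rmax 0 (beta u s) in
  if Rlt_dec v 0 then s ^ n * B ^ 5 * (12 * J - 18 * s ^ 2 - 2 * INR n * B) / J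
  else 0.

Definition cutoff_v (n : nat) (u v : R) : R :=
  let s := positive_root u v in
  let J := 3 * s ^ 2 + 2 * u in
  let B := Rmax 0 (beta u s) in
  if Rlt_dec v 0 then - (s ^ pred n * B ^ 5 * (INR n * B + 9 * s ^ 2)) / J
  else 0.

Lemma is_derive_cutoff_neg n (a b : R -> R) x a' b' :
  (1 <= n)%nat -> is_derive a x a' -> is_derive b x b' -> b x < 0 ->
  is_derive (fun y => cutoff n (a y) (b y)) x
    (cutoff_u n (a x) (b x) * a' + cutoff_v n (a x) (b x) * b').
Proof.
  intros hn Ha Hb hb.
  pose proof (is_derive_positive_root a b x a' b' Ha Hb hb) as Hs.
  destruct (positive_root_spec (a x) (b x) hb) as [hs es].
  pose proof (positive_root_simple _ _ _ hb hs es) as hJ.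
  set (s := fun y => positive_root (a y) (b y)) in *.
  change (positive_root (a x) (b x)) with (s x) in *.
  apply is_derive_ext_loc with (f := fun y => s y ^ n * Rmax 0 (beta (a y) (s y)) ^ 6).
  - generalize (is_derive_continuous _ _ _ Hb _ (open_lt 0 (b x) hb)).
    unfold filtermap. apply filter_imp. intros y hy. unfold cutoff.
    destruct (Rlt_dec (b y) 0); [reflexivity|lra].
  - unfold cutoff_u, cutoff_v. destruct (Rlt_dec (b x) 0); [|lra].
    change (positive_root (a x) (b x)) with (s x).
    pose proof (is_derive_beta a s x _ _ Ha Hs) as Hbeta.
    pose proof (is_derive_comp (fun z => Rmax 0 z ^ 6) (fun y => beta (a y) (s y)) x
                  _ _ (is_derive_pos_part_pow6 (beta (a x) (s x)))
                  Hbeta) as H6.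
    pose proof (is_derive_pow s n x _ Hs) as Hp.
    pose proof (is_derive_mult _ _ _ _ _ Hp H6 Rmult_comm) as Hm.
    match type of Hm with is_derive _ _ ?l1 =>
      match goal with |- is_derive _ _ ?l2 => replace l2 with l1 end end;
      [exact Hm|].
    unfold plus, mult, scal; simpl. unfold mult; simpl.
    set (B := Rmax 0 (beta (a x) (s x))).
    destruct n as [|n]; [lia|].
    change (pred (S n)) with n. rewrite <- !tech_pow_Rmult. field. lra.
Qed.

(** The identity [v = - s (s^2/4 + beta)] makes [s beta] small near [v = 0]; this is what
    glues the cut-offs to [0] across that line. *)
Lemma root_times_beta_le u v : v < 0 ->
  positive_root u v * Rmax 0 (beta u (positive_root u v)) <= - v.
Proof.
  intros hv. destruct (positive_root_spec u v hv) as [hs es].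
  set (s := positive_root u v) in *.
  assert (hv' : - v = s * (s ^ 2 / 4 + beta u s)) by (unfold beta; nra).
  unfold Rmax. destruct (Rle_dec 0 (beta u s)); nra.
Qed.

Lemma positive_root_le M u v : v < 0 -> Rabs u <= M -> Rabs v <= M ->
  positive_root u v <= 1 + 3 * M.
Proof.
  intros hv hu hv'. destruct (positive_root_spec u v hv) as [hs es].
  pose proof (cubic_root_bound u v _ (Rlt_le _ _ hs) es). lra.
Qed.

Lemma cutoff_factor_bound M n u v : (2 <= n)%nat -> v < 0 ->
  Rabs u <= M -> Rabs v <= M ->
  let s := positive_root u v in
  let B := Rmax 0 (beta u s) in
  0 <= s ^ n * B ^ 5 <= (1 + 3 * M) ^ (n - 2) * (2 * M + (1 + 3 * M) ^ 2) ^ 3 * v ^ 2.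
Proof.
  intros hn hv hu hv' s B.
  destruct (positive_root_spec u v hv) as [hs es]. fold s in hs, es.
  pose proof (positive_root_le M u v hv hu hv') as hsM. fold s in hsM.
  pose proof (root_times_beta_le u v hv) as hsB. fold s in hsB. fold B in hsB.
  assert (hB : 0 <= B) by apply Rmax_l.
  assert (hBM : B <= 2 * M + (1 + 3 * M) ^ 2).
  { pose proof (Rle_abs u). pose proof (Rabs_pos u).
    apply Rmax_lub; [nra|]. unfold beta. nra. }
  assert (hP : s ^ n * B ^ 5 = s ^ (n - 2) * B ^ 3 * (s * B) ^ 2).
  { replace (s ^ n) with (s ^ (n - 2) * s ^ 2); [ring|].
    rewrite <- pow_add. f_equal. lia. }
  rewrite hP. split.
  - apply Rmult_le_pos; [apply Rmult_le_pos; apply pow_le; lra|apply pow2_ge_0].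
  - apply Rmult_le_compat.
    + apply Rmult_le_pos; apply pow_le; lra.
    + apply pow2_ge_0.
    + apply Rmult_le_compat; try (apply pow_le; lra); apply pow_incr; lra.
    + replace (v ^ 2) with ((- v) ^ 2) by ring. apply pow_incr. nra.
Qed.

(** Locally uniform quadratic smallness as [v] increases to [0]: what an extension
    by zero to [0 <= v] needs in order to be differentiable. *)
Definition flat_at_zero (g : R -> R -> R) : Prop :=
  forall M, exists C, 0 <= C /\ forall u v, Rabs u <= M -> Rabs v <= M ->
    Rabs (g u v) <= C * (Rmin 0 v) ^ 2.

Lemma cutoff_flat n : (2 <= n)%nat -> flat_at_zero (cutoff n).
Proof.
  intros hn M.
  pose (D := (1 + 3 * M) ^ (n - 2) * (2 * M + (1 + 3 * M) ^ 2) ^ 3).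
  destruct (Rle_dec 0 M) as [hM|hM].
  2: { exists 0. split; [lra|]. intros u v hu. pose proof (Rabs_pos u). lra. }
  assert (hD : 0 <= D) by (apply Rmult_le_pos; apply pow_le; nra).
  exists (D * (2 * M + (1 + 3 * M) ^ 2)). split; [nra|].
  intros u v hu hv. unfold cutoff. destruct (Rlt_dec v 0) as [h|h].
  - rewrite Rmin_right by lra.
    pose proof (cutoff_factor_bound M n u v hn h hu hv) as [h0 h1]. fold D in h1.
    pose proof (positive_root_le M u v h hu hv) as hsM.
    destruct (positive_root_spec u v h) as [hs _].
    set (s := positive_root u v) in *. set (B := Rmax 0 (beta u s)) in *.
    assert (hB : 0 <= B) by apply Rmax_l.
    assert (hBM : B <= 2 * M + (1 + 3 * M) ^ 2).
    { pose proof (Rle_abs u). apply Rmax_lub; [nra|]. unfold beta. nra. }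
    replace (s ^ n * B ^ 6) with (s ^ n * B ^ 5 * B) by ring.
    rewrite Rabs_right by nra.
    replace (D * (2 * M + (1 + 3 * M) ^ 2) * v ^ 2)
      with (D * v ^ 2 * (2 * M + (1 + 3 * M) ^ 2)) by ring.
    apply Rmult_le_compat; lra.
  - rewrite Rabs_R0, Rmin_left by lra. lra.
Qed.

Lemma cutoff_u_flat n : (2 <= n)%nat -> flat_at_zero (cutoff_u n).
Proof.
  intros hn M.
  pose (D := (1 + 3 * M) ^ (n - 2) * (2 * M + (1 + 3 * M) ^ 2) ^ 3).
  destruct (Rle_dec 0 M) as [hM|hM].
  2: { exists 0. split; [lra|]. intros u v hu. pose proof (Rabs_pos u). lra. }
  assert (hD : 0 <= D) by (apply Rmult_le_pos; apply pow_le; nra).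
  pose proof (pos_INR n) as hnp.
  exists (D * (20 + 2 * INR n)). split; [nra|].
  intros u v hu hv. unfold cutoff_u. destruct (Rlt_dec v 0) as [h|h].
  - rewrite Rmin_right by lra.
    pose proof (cutoff_factor_bound M n u v hn h hu hv) as [h0 h1]. fold D in h1.
    destruct (positive_root_spec u v h) as [hs es].
    pose proof (positive_root_simple u v _ h hs es) as hJ.
    set (s := positive_root u v) in *. set (B := Rmax 0 (beta u s)) in *.
    set (J := 3 * s ^ 2 + 2 * u) in *.
    assert (hQ : B = 0 \/ Rabs ((12 * J - 18 * s ^ 2 - 2 * INR n * B) / J)
                   <= 20 + 2 * INR n).
    { unfold B, Rmax. destruct (Rle_dec 0 (beta u s)) as [hb|hb]; [right|left; lra].
      assert (hJB : J = 9 / 4 * s ^ 2 + beta u s) by (unfold J, beta; field).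
      pose proof (pow2_ge_0 s).
      unfold Rdiv. rewrite Rabs_mult, (Rabs_right (/ J))
        by (apply Rle_ge, Rlt_le, Rinv_0_lt_compat, hJ).
      apply Rmult_le_reg_r with J; [exact hJ|].
      rewrite Rmult_assoc, Rinv_l, Rmult_1_r by lra.
      apply Rabs_le. rewrite hJB. nra. }
    destruct hQ as [hQ|hQ].
    + rewrite hQ. replace (s ^ n * 0 ^ 5 * (12 * J - 18 * s ^ 2 - 2 * INR n * 0) / J)
        with 0 by (field; lra).
      rewrite Rabs_R0. pose proof (pow2_ge_0 v). apply Rmult_le_pos; nra.
    + unfold Rdiv in *. rewrite Rmult_assoc, Rabs_mult, (Rabs_right (s ^ n * _)) by lra.
      replace (D * (20 + 2 * INR n) * v ^ 2) with (D * v ^ 2 * (20 + 2 * INR n)) by ring.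
      apply Rmult_le_compat; trivial. apply Rabs_pos.
  - rewrite Rabs_R0, Rmin_left by lra. lra.
Qed.

Lemma cutoff_v_flat n : (3 <= n)%nat -> flat_at_zero (cutoff_v n).
Proof.
  intros hn M.
  pose (D := (1 + 3 * M) ^ (pred n - 2) * (2 * M + (1 + 3 * M) ^ 2) ^ 3).
  destruct (Rle_dec 0 M) as [hM|hM].
  2: { exists 0. split; [lra|]. intros u v hu. pose proof (Rabs_pos u). lra. }
  assert (hD : 0 <= D) by (apply Rmult_le_pos; apply pow_le; nra).
  pose proof (pos_INR n) as hnp.
  exists (D * (4 + INR n)). split; [nra|].
  intros u v hu hv. unfold cutoff_v. destruct (Rlt_dec v 0) as [h|h].
  - rewrite Rmin_right by lra.
    pose proof (cutoff_factor_bound M (pred n) u v ltac:(lia) h hu hv) as [h0 h1].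
    fold D in h1.
    destruct (positive_root_spec u v h) as [hs es].
    pose proof (positive_root_simple u v _ h hs es) as hJ.
    set (s := positive_root u v) in *. set (B := Rmax 0 (beta u s)) in *.
    set (J := 3 * s ^ 2 + 2 * u) in *.
    assert (hQ : B = 0 \/ Rabs (- (INR n * B + 9 * s ^ 2) / J) <= 4 + INR n).
    { unfold B, Rmax. destruct (Rle_dec 0 (beta u s)) as [hb|hb]; [right|left; lra].
      assert (hJB : J = 9 / 4 * s ^ 2 + beta u s) by (unfold J, beta; field).
      pose proof (pow2_ge_0 s).
      unfold Rdiv. rewrite Rabs_mult, (Rabs_right (/ J))
        by (apply Rle_ge, Rlt_le, Rinv_0_lt_compat, hJ).
      apply Rmult_le_reg_r with J; [exact hJ|].
      rewrite Rmult_assoc, Rinv_l, Rmult_1_r by lra.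
      apply Rabs_le. rewrite hJB. nra. }
    replace (- (s ^ pred n * B ^ 5 * (INR n * B + 9 * s ^ 2)) / J)
      with (s ^ pred n * B ^ 5 * (- (INR n * B + 9 * s ^ 2) / J)) by (field; lra).
    destruct hQ as [hQ|hQ].
    + rewrite hQ. replace (s ^ pred n * 0 ^ 5 * (- (INR n * 0 + 9 * s ^ 2) / J))
        with 0 by (field; lra).
      rewrite Rabs_R0. pose proof (pow2_ge_0 v). apply Rmult_le_pos; nra.
    + rewrite Rabs_mult, (Rabs_right (s ^ pred n * _)) by lra.
      replace (D * (4 + INR n) * v ^ 2) with (D * v ^ 2 * (4 + INR n)) by ring.
      apply Rmult_le_compat; trivial. apply Rabs_pos.
  - rewrite Rabs_R0, Rmin_left by lra. lra.
Qed.

Lemma flat_zero g u v : flat_at_zero g -> 0 <= v -> g u v = 0.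
Proof.
  intros Hg hv. destruct (Hg (Rabs u + Rabs v)) as [C [hC H]].
  pose proof (Rabs_pos u). pose proof (Rabs_pos v).
  specialize (H u v ltac:(lra) ltac:(lra)). rewrite Rmin_left in H by lra.
  pose proof (Rabs_pos (g u v)). apply Rabs_eq_0. lra.
Qed.

Lemma Rmin_0_sq_le v v' : 0 <= v -> Rmin 0 v' ^ 2 <= (v' - v) ^ 2.
Proof.
  intros hv. unfold Rmin. destruct (Rle_dec 0 v').
  - pose proof (pow2_ge_0 (v' - v)). lra.
  - nra.
Qed.

Lemma locally_Rabs_le (a : R -> R) x M :
  continuous a x -> Rabs (a x) < M -> locally x (fun y => Rabs (a y) <= M).
Proof.
  intros Ha hM.
  assert (Hc : continuous (fun y => Rabs (a y)) x).
  { apply (continuous_comp a Rabs); trivial. apply continuous_Rabs. }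
  generalize (Hc _ (open_lt M _ hM)). unfold filtermap. apply filter_imp.
  intros; lra.
Qed.

Lemma is_derive_flat g (a b : R -> R) x a' b' : flat_at_zero g ->
  is_derive a x a' -> is_derive b x b' -> 0 <= b x ->
  is_derive (fun y => g (a y) (b y)) x 0.
Proof.
  intros Hg Ha Hb hb.
  pose proof (is_derive_continuous _ _ _ Ha) as Hac.
  pose proof (is_derive_continuous _ _ _ Hb) as Hbc.
  pose proof (Rabs_pos (a x)). pose proof (Rabs_pos (b x)).
  set (M := Rabs (a x) + Rabs (b x) + 1).
  assert (hMa : Rabs (a x) < M) by (unfold M; lra).
  assert (hMb : Rabs (b x) < M) by (unfold M; lra).
  destruct (Hg M) as [C [hC HC]].
  assert (Hnear : locally x (fun y => Rabs (g (a y) (b y)) <= C * (b y - b x) ^ 2)).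
  { generalize (filter_and _ _ (locally_Rabs_le a x M Hac hMa)
      (locally_Rabs_le b x M Hbc hMb)).
    apply filter_imp. intros y [h1 h2].
    apply Rle_trans with (1 := HC _ _ h1 h2).
    apply Rmult_le_compat_l; trivial. now apply Rmin_0_sq_le. }
  pose (G y := g (a y) (b y) / (b y - b x)).
  assert (HGx : G x = 0) by (unfold G; rewrite (flat_zero g) by assumption; unfold Rdiv; ring).
  assert (HG : continuous G x).
  { intros P [e He]. rewrite HGx in He. unfold filtermap.
    assert (he : 0 < e / (C + 1)) by (apply Rdiv_lt_0_compat; [apply cond_pos|lra]).
    generalize (filter_and _ _ Hnear
      (Hbc _ (locally_ball (b x) (mkposreal _ he)))).
    apply filter_imp. intros y [h1 h2]. apply He.
    unfold ball in *. simpl in *. unfold AbsRing_ball, abs, minus, plus, opp in *.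
    simpl in *. fold (b y - b x) in h2.
    replace (G y + - 0) with (G y) by ring.
    destruct (Req_dec (b y - b x) 0) as [h0|h0].
    - unfold G. rewrite h0 in *. replace (g (a y) (b y)) with 0.
      + unfold Rdiv. rewrite Rmult_0_l, Rabs_R0. apply cond_pos.
      + symmetry. apply Rabs_eq_0. pose proof (Rabs_pos (g (a y) (b y))). lra.
    - unfold G, Rdiv. rewrite Rabs_mult, Rabs_inv.
      assert (0 < Rabs (b y - b x)) by now apply Rabs_pos_lt.
      apply Rmult_lt_reg_r with (Rabs (b y - b x)); trivial.
      rewrite Rmult_assoc, Rinv_l, Rmult_1_r by lra.
      apply Rle_lt_trans with (1 := h1).
      replace ((b y - b x) * ((b y - b x) * 1)) with (Rabs (b y - b x) ^ 2)
        by (rewrite pow2_abs; ring).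
      assert (C * Rabs (b y - b x) < e).
      { apply Rle_lt_trans with ((C + 1) * Rabs (b y - b x)); [nra|].
        apply Rlt_le_trans with ((C + 1) * (e / (C + 1))).
        - apply Rmult_lt_compat_l; lra.
        - right. field. lra. }
      nra. }
  assert (Hf : is_derive (fun y => b y - b x) x b').
  { replace b' with (b' - 0) by ring.
    apply (is_derive_minus b (fun _ => b x)); trivial.
    apply (is_derive_const (b x)). }
  pose proof (is_derive_mult_zero _ G x _ Hf (Rminus_diag (b x)) HG) as Hd.
  rewrite HGx, Rmult_0_r in Hd.
  apply is_derive_ext_loc with (2 := Hd). revert Hnear. apply filter_imp.
  intros y hy. eqR. unfold G.
  destruct (Req_dec (b y - b x) 0) as [h0|h0]; [|field; exact h0].
  rewrite h0 in *. rewrite Rmult_0_l. symmetry. apply Rabs_eq_0.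
  pose proof (Rabs_pos (g (a y) (b y))). lra.
Qed.

Lemma is_derive_cutoff n (a b : R -> R) x a' b' : (3 <= n)%nat ->
  is_derive a x a' -> is_derive b x b' ->
  is_derive (fun y => cutoff n (a y) (b y)) x
    (cutoff_u n (a x) (b x) * a' + cutoff_v n (a x) (b x) * b').
Proof.
  intros hn Ha Hb. destruct (Rlt_dec (b x) 0) as [hb|hb].
  - apply is_derive_cutoff_neg; trivial. lia.
  - rewrite (flat_zero (cutoff_u n)), (flat_zero (cutoff_v n)); try lra;
      [|apply cutoff_v_flat; lia|apply cutoff_u_flat; lia].
    replace (0 * a' + 0 * b') with 0 by ring.
    apply is_derive_flat with a' b'; trivial; [apply cutoff_flat; lia|lra].
Qed.

Lemma flat_continuous g : flat_at_zero g ->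
  (forall u v, v < 0 -> continuous (fun x : R * R => g (fst x) (snd x)) (u, v)) ->
  forall x, continuous (fun x : R * R => g (fst x) (snd x)) x.
Proof.
  intros Hg Hneg [u v]. destruct (Rlt_dec v 0) as [hv|hv]; [auto|].
  pose proof (Rabs_pos u). pose proof (Rabs_pos v).
  destruct (Hg (Rabs u + Rabs v + 1)) as [C [hC HC]].
  intros P [e He]. simpl in He. rewrite (flat_zero g) in He by (trivial; lra).
  assert (hd : 0 < Rmin 1 (e / (C + 1))).
  { apply Rmin_pos; [lra|]. apply Rdiv_lt_0_compat; [apply cond_pos|lra]. }
  exists (mkposreal _ hd). intros [u' v'] [h1 h2]. apply He.
  unfold ball in *; simpl in *. unfold AbsRing_ball, abs, minus, plus, opp in *.
  simpl in *.
  pose proof (Rmin_l 1 (e / (C + 1))). pose proof (Rmin_r 1 (e / (C + 1))).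
  fold (v' - v) in h2. fold (u' - u) in h1.
  replace (g u' v' + - 0) with (g u' v') by ring.
  assert (hu' : Rabs u' <= Rabs u + Rabs v + 1).
  { replace u' with (u + (u' - u)) by ring.
    eapply Rle_trans; [apply Rabs_triang|]. lra. }
  assert (hv' : Rabs v' <= Rabs u + Rabs v + 1).
  { replace v' with (v + (v' - v)) by ring.
    eapply Rle_trans; [apply Rabs_triang|]. lra. }
  specialize (HC u' v' hu' hv').
  pose proof (Rmin_0_sq_le v v' ltac:(lra)) as hm.
  rewrite <- (pow2_abs (v' - v)) in hm.
  pose proof (Rabs_pos (v' - v)). pose proof (cond_pos e).
  assert (hle : Rabs (g u' v') <= C * Rabs (v' - v)).
  { apply Rle_trans with (1 := HC). apply Rmult_le_compat_l; trivial. nra. }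
  apply Rle_lt_trans with (1 := hle).
  apply Rle_lt_trans with ((C + 1) * Rabs (v' - v)); [nra|].
  apply Rlt_le_trans with ((C + 1) * (e / (C + 1))).
  - apply Rmult_lt_compat_l; lra.
  - right. field. lra.
Qed.

Lemma locally_snd_neg u v : v < 0 -> locally (u, v) (fun x : R * R => snd x < 0).
Proof.
  intros hv.
  apply (@continuous_snd R_UniformSpace R_UniformSpace u v (fun y => y < 0)). apply (open_lt 0 v hv).
Qed.

Lemma continuous_root_and_beta u v : v < 0 ->
  continuous (fun x : R * R => fst x) (u, v) /\
  continuous (fun x : R * R => positive_root (fst x) (snd x)) (u, v) /\
  continuous (fun x : R * R =>
     Rmax 0 (beta (fst x) (positive_root (fst x) (snd x)))) (u, v).
Proof.
  intros hv.
  pose proof (@continuous_fst R_UniformSpace R_UniformSpace u v) as Hu.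
  pose proof (positive_root_continuous u v hv) as Hs.
  split; [exact Hu|]. split; [exact Hs|].
  apply (continuous_comp
    (fun x : R * R => beta (fst x) (positive_root (fst x) (snd x))) (Rmax 0)).
  - unfold beta. continuity_poly.
  - apply continuous_pos_part.
Qed.

Lemma continuous_if_neg (g : R * R -> R) u v : v < 0 -> continuous g (u, v) ->
  continuous (fun x : R * R => if Rlt_dec (snd x) 0 then g x else 0) (u, v).
Proof.
  intros hv. apply continuous_ext_loc.
  generalize (locally_snd_neg u v hv). apply filter_imp. intros [x y] h.
  simpl in *. destruct (Rlt_dec y 0); [reflexivity|lra].
Qed.

Lemma cutoff_continuous n x : (2 <= n)%nat ->
  continuous (fun x : R * R => cutoff n (fst x) (snd x)) x.
Proof.
  intros hn. revert x. apply flat_continuous; [now apply cutoff_flat|].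
  intros u v hv. destruct (continuous_root_and_beta u v hv) as [Hu [Hs HB]].
  apply (continuous_if_neg (fun x => positive_root (fst x) (snd x) ^ n *
    Rmax 0 (beta (fst x) (positive_root (fst x) (snd x))) ^ 6)); trivial.
  continuity_poly.
Qed.

Lemma cutoff_u_continuous n x : (2 <= n)%nat ->
  continuous (fun x : R * R => cutoff_u n (fst x) (snd x)) x.
Proof.
  intros hn. revert x. apply flat_continuous; [now apply cutoff_u_flat|].
  intros u v hv. destruct (continuous_root_and_beta u v hv) as [Hu [Hs HB]].
  destruct (positive_root_spec u v hv) as [hs es].
  pose proof (positive_root_simple u v _ hv hs es) as hJ.
  apply (continuous_if_neg (fun x =>
    let s := positive_root (fst x) (snd x) in
    let J := 3 * s ^ 2 + 2 * fst x in
    let B := Rmax 0 (beta (fst x) s) in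
    s ^ n * B ^ 5 * (12 * J - 18 * s ^ 2 - 2 * INR n * B) / J)); trivial.
  cbv zeta. continuity_poly. simpl in *. lra.
Qed.

Lemma cutoff_v_continuous n x : (3 <= n)%nat ->
  continuous (fun x : R * R => cutoff_v n (fst x) (snd x)) x.
Proof.
  intros hn. revert x. apply flat_continuous; [now apply cutoff_v_flat|].
  intros u v hv. destruct (continuous_root_and_beta u v hv) as [Hu [Hs HB]].
  destruct (positive_root_spec u v hv) as [hs es].
  pose proof (positive_root_simple u v _ hv hs es) as hJ.
  apply (continuous_if_neg (fun x =>
    let s := positive_root (fst x) (snd x) in
    let J := 3 * s ^ 2 + 2 * fst x in
    let B := Rmax 0 (beta (fst x) s) in
    - (s ^ pred n * B ^ 5 * (INR n * B + 9 * s ^ 2)) / J)); trivial.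
  cbv zeta. continuity_poly. simpl in *. lra.
Qed.

(** * The equations for the coefficients *)

(** The equations [F_t + p F_q - u_q F_p = 0], sorted by powers of [p]; they are a
    reduction of Benney's chain of moment equations. *)
Record benney (Tq Tt : R) (u v w : R -> R -> R) : Prop := {
  benney_su : smooth u; benney_sv : smooth v; benney_sw : smooth w;
  benney_pu : biperiodic Tq Tt u; benney_pv : biperiodic Tq Tt v;
  benney_pw : biperiodic Tq Tt w;
  benney_u : forall q t, dt u q t = - dq v q t;
  benney_v : forall q t, dt v q t = 2 * u q t * dq u q t - dq w q t;
  benney_w : forall q t, dt w q t = dq u q t * v q t }.

(** * The region with one real critical point *)

Lemma nondecreasing_flat (f g : R -> R) a b :
  (forall x, is_derive f x (g x)) -> (forall x, 0 <= g x) -> f a = f b ->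
  forall x, a < x < b -> g x = 0.
Proof.
  intros Hd Hg Hab x hx.
  assert (Hmono : forall y z, y <= z -> f y <= f z).
  { intros y z hyz.
    destruct (MVT_gen f y z g) as [c [_ Hc]].
    - intros; apply Hd.
    - intros c _. apply continuity_pt_filterlim, (is_derive_continuous f c (g c)), Hd.
    - pose proof (Hg c). nra. }
  apply (is_derive_at_max f x); [apply Hd|].
  assert (Hlt : locally x (fun y => y < b)) by apply (open_lt b x (proj2 hx)).
  revert Hlt. apply filter_imp. intros y hy.
  apply Rle_trans with (f b); [apply Hmono; lra|].
  rewrite <- Hab. apply Hmono. lra.
Qed.

Lemma continuous_slice_q (g : R -> R -> R) q t :
  continuous (fun x : R * R => g (fst x) (snd x)) (q, t) ->
  continuous (fun z => g z t) q.
Proof.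
  intros H. apply (continuous_comp_2 (fun z => z) (fun _ => t) g); trivial.
  - apply continuous_id.
  - apply continuous_const.
Qed.

(** A divergence [dP/dt + dQ/dq] of periodic functions that is nonnegative
    vanishes: the mean of [P] over a period in [q] is nondecreasing and periodic
    in [t]. *)
Lemma nonneg_divergence_zero Tq Tt (P Q Pt Qq : R -> R -> R) :
  0 < Tq -> 0 < Tt -> biperiodic Tq Tt P -> biperiodic Tq Tt Q ->
  (forall x, continuous (fun x : R * R => P (fst x) (snd x)) x) ->
  (forall x, continuous (fun x : R * R => Pt (fst x) (snd x)) x) ->
  (forall x, continuous (fun x : R * R => Qq (fst x) (snd x)) x) ->
  (forall q t, is_derive (fun z => P q z) t (Pt q t)) ->
  (forall q t, is_derive (fun z => Q z t) q (Qq q t)) ->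
  (forall q t, 0 <= Pt q t + Qq q t) ->
  forall q t, Pt q t + Qq q t = 0.
Proof.
  intros hTq hTt pP pQ cP cPt cQq dP dQ Hpos q0 t0.
  set (a := q0 - Tq / 2). set (b := a + Tq).
  assert (cS : forall t q, continuous (fun z => Pt z t + Qq z t) q).
  { intros t q. apply continuous_Rplus;
      [apply (continuous_slice_q Pt), cPt|apply (continuous_slice_q Qq), cQq]. }
  assert (iS : forall t x y, ex_RInt (fun z => Pt z t + Qq z t) x y).
  { intros t x y. apply (ex_RInt_continuous (V := R_CompleteNormedModule)).
    intros z _. apply cS. }
  assert (iPt : forall t x y, ex_RInt (fun z => Pt z t) x y).
  { intros t x y. apply (ex_RInt_continuous (V := R_CompleteNormedModule)).
    intros z _. apply (continuous_slice_q Pt), cPt. }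
  assert (hQ : forall t, is_RInt (fun z => Qq z t) a b 0).
  { intros t. replace 0 with (minus (Q b t) (Q a t)).
    - apply (is_RInt_derive (V := R_CompleteNormedModule) (fun z => Q z t)).
      + intros z _. apply dQ.
      + intros z _. apply (continuous_slice_q Qq), cQq.
    - unfold b. rewrite (proj1 (pQ a t)). unfold minus, plus, opp; simpl. ring. }
  assert (hI : forall t, is_derive (fun t => RInt (fun z => P z t) a b) t
                (RInt (fun z => Pt z t + Qq z t) a b)).
  { intros t.
    replace (RInt (fun z => Pt z t + Qq z t) a b)
      with (RInt (fun z => Derive (fun t => P z t) t) a b).
    - apply (is_derive_RInt_param (fun t z => P z t) a b t).
      + apply filter_forall. intros t' z _. exists (Pt z t'). apply dP.
      + intros z _. apply continuity_2d_pt_ext with (f := fun t z => Pt z t).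
        * intros x y. symmetry. apply is_derive_unique, dP.
        * apply continuity_2d_pt_filterlim.
          apply (continuous_comp_2 (fun x : R * R => snd x) (fun x => fst x) Pt);
            [apply continuous_snd|apply continuous_fst|apply cPt].
      + apply filter_forall. intros t'.
        apply (ex_RInt_continuous (V := R_CompleteNormedModule)).
        intros z _. apply (continuous_slice_q P), cP.
    - symmetry. apply is_RInt_unique.
      replace (RInt (fun z => Derive (fun t => P z t) t) a b)
        with (plus (RInt (fun z => Pt z t) a b) 0).
      + apply (is_RInt_plus (V := R_NormedModule)); [|apply hQ].
        apply (RInt_correct (V := R_CompleteNormedModule)), iPt.
      + unfold plus; simpl. rewrite Rplus_0_r. apply RInt_ext. intros z _. symmetry.
        apply is_derive_unique, dP. }
  assert (hab : a < b) by (unfold b; lra).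
  assert (hint : RInt (fun z => Pt z t0 + Qq z t0) a b = 0).
  { apply (nondecreasing_flat (fun t => RInt (fun z => P z t) a b)
      (fun t => RInt (fun z => Pt z t + Qq z t) a b) (t0 - Tt) (t0 + Tt)).
    - exact hI.
    - intros t. apply RInt_ge_0; [lra|apply iS|]. intros z _. apply Hpos.
    - apply RInt_ext. intros z _. eqR.
      rewrite (proj2 (pP z t0)), <- (proj2 (pP z (t0 - Tt))).
      f_equal. ring.
    - lra. }
  apply (nondecreasing_flat (fun x => RInt (fun z => Pt z t0 + Qq z t0) a x)
    (fun z => Pt z t0 + Qq z t0) a b).
  - intros x. apply (is_derive_RInt (V := R_NormedModule) (fun z => Pt z t0 + Qq z t0) _ a x); [|apply cS].
    apply filter_forall. intros y.
    apply (RInt_correct (V := R_CompleteNormedModule)), iS.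
  - intros x. apply Hpos.
  - rewrite hint. apply (RInt_point (V := R_CompleteNormedModule)).
  - unfold b, a. lra.
Qed.

(* Closes a derivative of an expression in functions whose derivatives are
   among the hypotheses. *)
Ltac derive_by_hyps :=
  auto_derive;
  [ repeat split; try (eexists; eassumption)
  | repeat match goal with
      |- context [Derive ?g ?x] =>
        match goal with
          H : is_derive ?f x ?l |- _ =>
            replace (Derive g x) with l by (symmetry; apply (is_derive_unique f); exact H)
        end
      end; eqR ].

Lemma benney_dq_u Tq Tt u v w : benney Tq Tt u v w ->
  forall q t, dt (dq u) q t = - dq (dq v) q t.
Proof.
  intros H q t. rewrite smooth_schwarz by apply H.
  apply is_derive_unique.
  apply is_derive_ext with (f := fun x => - dq v x t).
  - intros x. symmetry. apply (benney_u _ _ _ _ _ H).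
  - apply (is_derive_opp (fun x => dq v x t)), smooth_is_derive_q, smooth_dq, H.
Qed.

Lemma benney_dq_v Tq Tt u v w : benney Tq Tt u v w ->
  forall q t, dt (dq v) q t =
    2 * dq u q t ^ 2 + 2 * u q t * dq (dq u) q t - dq (dq w) q t.
Proof.
  intros H q t. rewrite smooth_schwarz by apply H.
  apply is_derive_unique.
  apply is_derive_ext with (f := fun x => 2 * u x t * dq u x t - dq w x t).
  - intros x. symmetry. apply (benney_v _ _ _ _ _ H).
  - pose proof (smooth_is_derive_q u (benney_su _ _ _ _ _ H) q t).
    pose proof (smooth_is_derive_q _ (smooth_dq u (benney_su _ _ _ _ _ H)) q t).
    pose proof (smooth_is_derive_q _ (smooth_dq w (benney_sw _ _ _ _ _ H)) q t).
    derive_by_hyps. ring.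
Qed.

Lemma benney_dq_w Tq Tt u v w : benney Tq Tt u v w ->
  forall q t, dt (dq w) q t = dq (dq u) q t * v q t + dq u q t * dq v q t.
Proof.
  intros H q t. rewrite smooth_schwarz by apply H.
  apply is_derive_unique.
  apply is_derive_ext with (f := fun x => dq u x t * v x t).
  - intros x. symmetry. apply (benney_w _ _ _ _ _ H).
  - pose proof (smooth_is_derive_q v (benney_sv _ _ _ _ _ H) q t).
    pose proof (smooth_is_derive_q _ (smooth_dq u (benney_su _ _ _ _ _ H)) q t).
    derive_by_hyps. ring.
Qed.

(** With [c4 = phi(Y)], [c5 = s phi(Y)] and [c6 = s^2 phi(Y)], and [a], [b], [c]
    the derivatives of [u], [v], [w], this is [phi(Y) dX]: at a critical point [r]
    of the quartic [dX = Re (dw + r dv + r^2 du)], and for [r = - s/2 + i b] one has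
    [Re r^2 = s^2/4 - beta = - (s^2/2 + 2 u)]. *)
Definition weighted_form (c4 c5 c6 u a b c : R) : R :=
  c4 * c - / 2 * c5 * b - (/ 2 * c6 + 2 * u * c4) * a.

Lemma is_derive_weighted_form (c4 c5 c6 u a b c : R -> R) x
    c4' c5' c6' u' a' b' c' :
  is_derive c4 x c4' -> is_derive c5 x c5' -> is_derive c6 x c6' ->
  is_derive u x u' -> is_derive a x a' -> is_derive b x b' -> is_derive c x c' ->
  is_derive (fun y => weighted_form (c4 y) (c5 y) (c6 y) (u y) (a y) (b y) (c y)) x
    (weighted_form c4' c5' c6' (u x) (a x) (b x) (c x)
     + weighted_form (c4 x) (c5 x) (c6 x) (u x) a' b' c'
     - 2 * u' * c4 x * a x).
Proof. intros. unfold weighted_form. derive_by_hyps. ring. Qed.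

Lemma continuous_weighted_form (U : UniformSpace) (c4 c5 c6 u a b c : U -> R) x :
  continuous c4 x -> continuous c5 x -> continuous c6 x -> continuous u x ->
  continuous a x -> continuous b x -> continuous c x ->
  continuous (fun y =>
    weighted_form (c4 y) (c5 y) (c6 y) (u y) (a y) (b y) (c y)) x.
Proof. intros. unfold weighted_form. continuity_poly. Qed.

(** The left-hand side is [phi'(Y) (Y_t X_q - Y_q X_t)] for [phi(Y) = Y^4] and
    [Y = - s b^3], where [B = b^2]. Since [R = X + i Y] satisfies
    [R_t + r R_q = 0] with [Im r = b], the bracket is [- b |R_q|^2]; the squares on
    the right are those of [Re R_q] and of [Im R_q / b]. *)
Lemma divergence_identity s B uq vq wq :
  let u := (B - 3 / 4 * s ^ 2) / 2 in
  let v := - (s ^ 3 + 2 * u * s) in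
  let J := 3 * s ^ 2 + 2 * u in
  let ut := - vq in
  let vt := 2 * u * uq - wq in
  let wt := uq * v in
  let Cu (n : R) sn := sn * B ^ 5 * (12 * J - 18 * s ^ 2 - 2 * n * B) / J in
  let Cv (n : R) sn' := - (sn' * B ^ 5 * (n * B + 9 * s ^ 2)) / J in
  J <> 0 ->
  weighted_form
    (Cu 4 (s ^ 4) * ut + Cv 4 (s ^ 3) * vt)
    (Cu 5 (s ^ 5) * ut + Cv 5 (s ^ 4) * vt)
    (Cu 6 (s ^ 6) * ut + Cv 6 (s ^ 5) * vt) u uq vq wq
  - weighted_form
    (Cu 4 (s ^ 4) * uq + Cv 4 (s ^ 3) * vq)
    (Cu 5 (s ^ 5) * uq + Cv 5 (s ^ 4) * vq)
    (Cu 6 (s ^ 6) * uq + Cv 6 (s ^ 5) * vq) u ut vt wt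
  = 4 * s ^ 3 * B ^ 5 *
    ((wq - s / 2 * vq - (s ^ 2 / 2 + 2 * u) * uq) ^ 2 + B * (vq - s * uq) ^ 2).
Proof.
  intros. unfold weighted_form, Cu, Cv, wt, vt, ut, v. unfold J in *. unfold u in *.
  field. lra.
Qed.

Lemma continuous_compose_uv (g : R -> R -> R) u v : smooth u -> smooth v ->
  (forall x, continuous (fun x : R * R => g (fst x) (snd x)) x) ->
  forall x, continuous (fun x : R * R => g (u (fst x) (snd x)) (v (fst x) (snd x))) x.
Proof.
  intros su sv Hg x.
  apply (continuous_comp_2 (fun x : R * R => u (fst x) (snd x))
           (fun x => v (fst x) (snd x)) g); trivial;
  now apply smooth_continuous.
Qed.

Definition weight (n : nat) (u v : R -> R -> R) (q t : R) : R :=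
  cutoff n (u q t) (v q t).
Definition weight_deriv (n : nat) (u v : R -> R -> R) (f g : R -> R -> R)
    (q t : R) : R :=
  cutoff_u n (u q t) (v q t) * f q t + cutoff_v n (u q t) (v q t) * g q t.

Lemma is_derive_weight_t n u v q t : (3 <= n)%nat -> smooth u -> smooth v ->
  is_derive (fun y => weight n u v q y) t (weight_deriv n u v (dt u) (dt v) q t).
Proof.
  intros hn su sv.
  apply (is_derive_cutoff n (fun y => u q y) (fun y => v q y));
    trivial; now apply smooth_is_derive_t.
Qed.

Lemma is_derive_weight_q n u v q t : (3 <= n)%nat -> smooth u -> smooth v ->
  is_derive (fun y => weight n u v y t) q (weight_deriv n u v (dq u) (dq v) q t).
Proof.
  intros hn su sv.
  apply (is_derive_cutoff n (fun y => u y t) (fun y => v y t));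
    trivial; now apply smooth_is_derive_q.
Qed.

(** The two conclusions say [Im R_q = 0] and [Re R_q = 0] for the complex critical
    value [R]. The divergence of [(Q, P)] below contains no second derivatives,
    because mixed partial derivatives commute, and [divergence_identity] makes it
    nonnegative. *)
Lemma elliptic_relations Tq Tt u v w : 0 < Tq -> 0 < Tt -> benney Tq Tt u v w ->
  forall q t s, v q t < 0 -> 0 < s -> s ^ 3 + 2 * u q t * s + v q t = 0 ->
  0 < beta (u q t) s ->
  dq v q t = s * dq u q t /\ dq w q t = (s ^ 2 + 2 * u q t) * dq u q t.
Proof.
  intros hTq hTt H.
  pose proof (benney_su _ _ _ _ _ H) as su. pose proof (benney_sv _ _ _ _ _ H) as sv.
  pose proof (benney_sw _ _ _ _ _ H) as sw.
  pose (form (f g h : R -> R -> R) q t := weighted_form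
    (weight 4 u v q t) (weight 5 u v q t) (weight 6 u v q t) (u q t)
    (f q t) (g q t) (h q t)).
  pose (form' (f g : R -> R -> R) (a b c : R -> R -> R) q t := weighted_form
    (weight_deriv 4 u v f g q t) (weight_deriv 5 u v f g q t)
    (weight_deriv 6 u v f g q t) (u q t) (a q t) (b q t) (c q t)).
  pose (P := form (dq u) (dq v) (dq w)).
  pose (Q q t := - form (dt u) (dt v) (dt w) q t).
  pose (Pt q t := form' (dt u) (dt v) (dq u) (dq v) (dq w) q t
    + form (dt (dq u)) (dt (dq v)) (dt (dq w)) q t
    - 2 * dt u q t * weight 4 u v q t * dq u q t).
  pose (Qq q t := - (form' (dq u) (dq v) (dt u) (dt v) (dt w) q t
    + form (dq (dt u)) (dq (dt v)) (dq (dt w)) q t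
    - 2 * dq u q t * weight 4 u v q t * dt u q t)).
  assert (Hw : forall n, (3 <= n)%nat -> forall x,
    continuous (fun x : R * R => weight n u v (fst x) (snd x)) x).
  { intros n hn x. apply (continuous_compose_uv (cutoff n)); trivial.
    intros y. apply cutoff_continuous. lia. }
  assert (Hw' : forall n, (3 <= n)%nat -> forall f g, smooth f -> smooth g ->
    forall x, continuous (fun x : R * R => weight_deriv n u v f g (fst x) (snd x)) x).
  { intros n hn f g sf sg x. unfold weight_deriv.
    pose proof (smooth_continuous f sf x). pose proof (smooth_continuous g sg x).
    continuity_poly.
    - apply (continuous_compose_uv (cutoff_u n)); trivial.
      intros y. apply cutoff_u_continuous. lia.
    - apply (continuous_compose_uv (cutoff_v n)); trivial.
      intros y. apply cutoff_v_continuous. lia. }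
  assert (Hform : forall f g h, smooth f -> smooth g -> smooth h -> forall x,
    continuous (fun x : R * R => form f g h (fst x) (snd x)) x).
  { intros f g h sf sg sh x. unfold form.
    apply continuous_weighted_form; try apply Hw; try lia;
    now apply smooth_continuous. }
  assert (Hform' : forall f g a b c, smooth f -> smooth g -> smooth a -> smooth b ->
    smooth c -> forall x,
    continuous (fun x : R * R => form' f g a b c (fst x) (snd x)) x).
  { intros f g a b c sf sg sa sb sc x. unfold form'.
    apply continuous_weighted_form; try apply Hw'; try lia; trivial;
    now apply smooth_continuous. }
  assert (Hdiv : forall q t, Pt q t + Qq q t =
    form' (dt u) (dt v) (dq u) (dq v) (dq w) q t
    - form' (dq u) (dq v) (dt u) (dt v) (dt w) q t).
  { intros q t. unfold Pt, Qq, form.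
    rewrite (smooth_schwarz u su), (smooth_schwarz v sv), (smooth_schwarz w sw). ring. }
  assert (Hval : forall q t, v q t < 0 ->
    let s := positive_root (u q t) (v q t) in
    Pt q t + Qq q t = 4 * s ^ 3 * Rmax 0 (beta (u q t) s) ^ 5 *
      ((dq w q t - s / 2 * dq v q t - (s ^ 2 / 2 + 2 * u q t) * dq u q t) ^ 2
       + beta (u q t) s * (dq v q t - s * dq u q t) ^ 2)).
  { intros q t hv s. rewrite Hdiv.
    destruct (positive_root_spec (u q t) (v q t) hv) as [hs es].
    pose proof (positive_root_simple _ _ _ hv hs es) as hJ. fold s in hs, es, hJ.
    unfold form', weight_deriv, cutoff_u, cutoff_v.
    destruct (Rlt_dec (v q t) 0) as [_|]; [|lra]. fold s.
    rewrite (benney_u _ _ _ _ _ H), (benney_v _ _ _ _ _ H), (benney_w _ _ _ _ _ H).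
    destruct (Rle_dec 0 (beta (u q t) s)) as [hb|hb].
    - rewrite Rmax_right by exact hb.
      replace (v q t) with (- (s ^ 3 + 2 * u q t * s)) by lra.
      pose proof (divergence_identity s (beta (u q t) s) (dq u q t) (dq v q t) (dq w q t)) as Hi.
      cbv zeta in Hi.
      replace ((beta (u q t) s - 3 / 4 * s ^ 2) / 2) with (u q t) in Hi
        by (unfold beta; field).
      replace (INR 4) with 4 by (simpl; ring). replace (INR 5) with 5 by (simpl; ring).
      replace (INR 6) with 6 by (simpl; ring).
      change (pred 4) with 3%nat. change (pred 5) with 4%nat. change (pred 6) with 5%nat.
      apply Hi. lra.
    - rewrite Rmax_left by lra. unfold weighted_form. field. lra. }
  assert (Hzero : forall q t, Pt q t + Qq q t = 0).
  { apply (nonneg_divergence_zero Tq Tt P Q Pt Qq); trivial.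
    - intros q t. unfold P, form, weight.
      rewrite (proj1 (benney_pu _ _ _ _ _ H q t)), (proj2 (benney_pu _ _ _ _ _ H q t)).
      rewrite (proj1 (benney_pv _ _ _ _ _ H q t)), (proj2 (benney_pv _ _ _ _ _ H q t)).
      pose proof (biperiodic_dq _ _ _ (benney_pu _ _ _ _ _ H) q t) as [-> ->].
      pose proof (biperiodic_dq _ _ _ (benney_pv _ _ _ _ _ H) q t) as [-> ->].
      pose proof (biperiodic_dq _ _ _ (benney_pw _ _ _ _ _ H) q t) as [-> ->]. auto.
    - intros q t. unfold Q, form, weight.
      rewrite (proj1 (benney_pu _ _ _ _ _ H q t)), (proj2 (benney_pu _ _ _ _ _ H q t)).
      rewrite (proj1 (benney_pv _ _ _ _ _ H q t)), (proj2 (benney_pv _ _ _ _ _ H q t)).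
      pose proof (biperiodic_dt _ _ _ (benney_pu _ _ _ _ _ H) q t) as [-> ->].
      pose proof (biperiodic_dt _ _ _ (benney_pv _ _ _ _ _ H) q t) as [-> ->].
      pose proof (biperiodic_dt _ _ _ (benney_pw _ _ _ _ _ H) q t) as [-> ->]. auto.
    - intros x. apply Hform; now apply smooth_dq.
    - intros x. unfold Pt.
      pose proof (Hform' (dt u) (dt v) (dq u) (dq v) (dq w) (smooth_dt u su)
        (smooth_dt v sv) (smooth_dq u su) (smooth_dq v sv) (smooth_dq w sw) x).
      pose proof (Hform (dt (dq u)) (dt (dq v)) (dt (dq w))
        (smooth_dt _ (smooth_dq u su)) (smooth_dt _ (smooth_dq v sv))
        (smooth_dt _ (smooth_dq w sw)) x).
      pose proof (smooth_continuous _ (smooth_dt u su) x).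
      pose proof (smooth_continuous _ (smooth_dq u su) x).
      pose proof (Hw 4%nat ltac:(lia) x).
      continuity_poly.
    - intros x. unfold Qq.
      pose proof (Hform' (dq u) (dq v) (dt u) (dt v) (dt w) (smooth_dq u su)
        (smooth_dq v sv) (smooth_dt u su) (smooth_dt v sv) (smooth_dt w sw) x).
      pose proof (Hform (dq (dt u)) (dq (dt v)) (dq (dt w))
        (smooth_dq _ (smooth_dt u su)) (smooth_dq _ (smooth_dt v sv))
        (smooth_dq _ (smooth_dt w sw)) x).
      pose proof (smooth_continuous _ (smooth_dt u su) x).
      pose proof (smooth_continuous _ (smooth_dq u su) x).
      pose proof (Hw 4%nat ltac:(lia) x).
      continuity_poly.
    - intros q t.
      apply (is_derive_weighted_form (fun t => weight 4 u v q t) (fun t => weight 5 u v q t)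
        (fun t => weight 6 u v q t) (fun t => u q t) (fun t => dq u q t)
        (fun t => dq v q t) (fun t => dq w q t));
        [apply is_derive_weight_t; trivial; lia .. | now apply smooth_is_derive_t
        |apply (smooth_is_derive_t (dq u))|apply (smooth_is_derive_t (dq v))
        |apply (smooth_is_derive_t (dq w))]; now apply smooth_dq.
    - intros q t.
      apply (is_derive_opp (fun q => form (dt u) (dt v) (dt w) q t)).
      apply (is_derive_weighted_form (fun q => weight 4 u v q t) (fun q => weight 5 u v q t)
        (fun q => weight 6 u v q t) (fun q => u q t) (fun q => dt u q t)
        (fun q => dt v q t) (fun q => dt w q t));
        [apply is_derive_weight_q; trivial; lia .. | now apply smooth_is_derive_q
        |apply (smooth_is_derive_q (dt u))|apply (smooth_is_derive_q (dt v))
        |apply (smooth_is_derive_q (dt w))]; now apply smooth_dt.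
    - intros q t. destruct (Rlt_dec (v q t) 0) as [hv|hv].
      + rewrite Hval by exact hv. cbv zeta.
        destruct (positive_root_spec (u q t) (v q t) hv) as [hs es].
        set (s := positive_root (u q t) (v q t)) in *.
        unfold Rmax. destruct (Rle_dec 0 (beta (u q t) s)) as [hb|hb].
        * apply Rmult_le_pos.
          -- apply Rmult_le_pos; [|now apply pow_le].
             pose proof (pow_le s 3 (Rlt_le _ _ hs)). lra.
          -- apply Rplus_le_le_0_compat; [apply pow2_ge_0|].
             apply Rmult_le_pos; [exact hb|apply pow2_ge_0].
        * right. ring.
      + right. rewrite Hdiv. unfold form', weight_deriv, cutoff_u, cutoff_v, weighted_form.
        destruct (Rlt_dec (v q t) 0); [contradiction|]. ring. }
  intros q t s hv hs es hb.
  pose proof (Hzero q t) as H0. rewrite Hval in H0 by exact hv. cbv zeta in H0.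
  destruct (positive_root_spec (u q t) (v q t) hv) as [hs' es'].
  rewrite <- (positive_root_unique _ _ _ _ hv hs' hs es' es) in H0.
  rewrite Rmax_right in H0 by lra.
  assert (hpos : 0 < 4 * s ^ 3 * beta (u q t) s ^ 5).
  { apply Rmult_lt_0_compat; [|now apply pow_lt].
    pose proof (pow_lt s 3 hs). lra. }
  destruct (Rmult_integral _ _ H0) as [h|h]; [lra|].
  pose proof (pow2_ge_0 (dq w q t - s / 2 * dq v q t
    - (s ^ 2 / 2 + 2 * u q t) * dq u q t)) as h1.
  pose proof (pow2_ge_0 (dq v q t - s * dq u q t)) as h2.
  assert (h3 : (dq v q t - s * dq u q t) ^ 2 = 0) by nra.
  rewrite h3 in h. rewrite Rmult_0_r, Rplus_0_r in h.
  assert (e1 : dq v q t - s * dq u q t = 0) by nra.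
  assert (e2 : dq w q t - s / 2 * dq v q t - (s ^ 2 / 2 + 2 * u q t) * dq u q t = 0)
    by (apply Rsqr_0_uniq; unfold Rsqr; lra).
  split; [lra|]. nra.
Qed.

(** * Transport of the critical values *)

Lemma is_derive_along_line f c q t : smooth f ->
  is_derive (fun y => f (q + c * y) (t + y)) 0 (c * dq f q t + dt f q t).
Proof.
  intros sf.
  replace (c * dq f q t + dt f q t)
    with (dq f (q + c * 0) (t + 0) * c + dt f (q + c * 0) (t + 0) * 1)
    by (rewrite Rmult_0_r, !Rplus_0_r; ring).
  apply (smooth_is_derive_comp f (fun y => q + c * y) (fun y => t + y)); trivial;
    auto_derive; trivial; ring.
Qed.

(** For [F = p^4/4 + u p^2 + v p + w] these are [F_p], [F_pp] and [F_q]. *)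
Definition quartic_p (u v : R -> R -> R) (p q t : R) : R :=
  p ^ 3 + 2 * u q t * p + v q t.
Definition quartic_pp (u : R -> R -> R) (p q t : R) : R := 3 * p ^ 2 + 2 * u q t.
Definition quartic_q (u v w : R -> R -> R) (p q t : R) : R :=
  dq u q t * p ^ 2 + dq v q t * p + dq w q t.

Lemma is_derive_quadratic_sq_mult (a b c d r : R -> R) x a' b' c' d' r' :
  is_derive a x a' -> is_derive b x b' -> is_derive c x c' -> is_derive d x d' ->
  is_derive r x r' ->
  is_derive (fun y => (b y * r y ^ 2 + c y * r y + d y) ^ 2 * (3 * r y ^ 2 + 2 * a y)) x
    (2 * (b x * r x ^ 2 + c x * r x + d x)
       * (b' * r x ^ 2 + c' * r x + d' + (2 * b x * r x + c x) * r')
       * (3 * r x ^ 2 + 2 * a x)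
     + (b x * r x ^ 2 + c x * r x + d x) ^ 2 * (6 * r x * r' + 2 * a')).
Proof. intros. derive_by_hyps. ring. Qed.

Lemma is_derive_sq_mult_beta (a r : R -> R) x a' r' :
  is_derive a x a' -> is_derive r x r' ->
  is_derive (fun y => r y ^ 2 * beta (a y) (r y) ^ 3) x
    (2 * r x * r' * beta (a x) (r x) ^ 3
     + 3 * r x ^ 2 * beta (a x) (r x) ^ 2 * (2 * a' + 3 / 2 * r x * r')).
Proof. intros. unfold beta. derive_by_hyps. field. Qed.

(** Differentiating the equation of [F] gives, along [dq/dt = s] and following the
    critical point [s],
      [(F_q)' = F_q F_pq / F_pp]  and  [(F_pp)' = - 2 F_pq + 6 s F_q / F_pp],
    so [F_pq] cancels from the derivative of [F_q^2 F_pp]. Only the tangent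
    direction at [(q, t)] matters, hence the straight line. The last derivative is
    that of [Y^2]. *)
Lemma transport_along_root Tq Tt u v w q t s : benney Tq Tt u v w ->
  quartic_p u v s q t = 0 -> 0 < quartic_pp u s q t ->
  let K := quartic_q u v w s q t in
  let J := quartic_pp u s q t in
  let k := K / J - dq u q t in
  exists r : R -> R, r 0 = s /\ is_derive r 0 k /\
    locally 0 (fun y => quartic_p u v (r y) (q + s * y) (t + y) = 0) /\
    is_derive (fun y => quartic_q u v w (r y) (q + s * y) (t + y) ^ 2
                        * quartic_pp u (r y) (q + s * y) (t + y))
      0 (6 * s * K ^ 3 / J) /\
    is_derive (fun y => r y ^ 2 * beta (u (q + s * y) (t + y)) (r y) ^ 3) 0
      (2 * s * beta (u q t) s ^ 3 * k + 3 * s ^ 2 * beta (u q t) s ^ 2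
         * (2 * (s * dq u q t - dq v q t) + 3 / 2 * s * k)).
Proof.
  intros H hc hJ K J k.
  pose proof (benney_su _ _ _ _ _ H) as su. pose proof (benney_sv _ _ _ _ _ H) as sv.
  pose proof (benney_sw _ _ _ _ _ H) as sw.
  pose proof (is_derive_along_line u s q t su) as Hu.
  pose proof (is_derive_along_line v s q t sv) as Hv.
  pose proof (is_derive_along_line (dq u) s q t (smooth_dq u su)) as Huq.
  pose proof (is_derive_along_line (dq v) s q t (smooth_dq v sv)) as Hvq.
  pose proof (is_derive_along_line (dq w) s q t (smooth_dq w sw)) as Hwq.
  rewrite (benney_dq_u _ _ _ _ _ H) in Huq. rewrite (benney_dq_v _ _ _ _ _ H) in Hvq.
  rewrite (benney_dq_w _ _ _ _ _ H) in Hwq.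
  rewrite (benney_u _ _ _ _ _ H) in Hu. rewrite (benney_v _ _ _ _ _ H) in Hv.
  assert (e0 : forall f : R -> R -> R, f (q + s * 0) (t + 0) = f q t).
  { intros f. f_equal; ring. }
  destruct (cubic_root_branch (fun y => u (q + s * y) (t + y))
    (fun y => v (q + s * y) (t + y)) 0 s _ _ Hu Hv) as [r [hr [Hr Hroot]]].
  { rewrite !e0. exact hc. } { rewrite e0. exact hJ. }
  rewrite e0 in Hr.
  assert (hv : v q t = - (s ^ 3 + 2 * u q t * s)) by (unfold quartic_p in hc; lra).
  assert (Hr' : is_derive r 0 k).
  { replace k with (- (2 * s * (s * dq u q t + - dq v q t)
      + (s * dq v q t + (2 * u q t * dq u q t - dq w q t))) / (3 * s ^ 2 + 2 * u q t));
      [exact Hr|].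
    unfold k, K, J, quartic_q, quartic_pp in *. field. lra. }
  clear Hr.
  exists r. split; [exact hr|]. split; [exact Hr'|]. split; [exact Hroot|]. split.
  - pose proof (is_derive_quadratic_sq_mult _ _ _ _ _ _ _ _ _ _ _ Hu Huq Hvq Hwq Hr') as Hd.
    cbv beta in Hd. rewrite !e0, hr in Hd.
    match type of Hd with is_derive _ _ ?l1 =>
      replace (6 * s * K ^ 3 / J) with l1; [exact Hd|] end.
    unfold k, K, J, quartic_q, quartic_pp in *. rewrite hv. field. lra.
  - pose proof (is_derive_sq_mult_beta _ _ _ _ _ Hu Hr') as Hd.
    cbv beta in Hd. rewrite !e0, hr in Hd.
    match type of Hd with is_derive _ _ ?l1 =>
      match goal with |- is_derive _ _ ?l2 => replace l2 with l1; [exact Hd|] end end.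
    field.
Qed.

(** * Vanishing of the derivatives of the critical values *)

Lemma continuous_p (x : R * R * R) : continuous (fun x : R * R * R => fst (fst x)) x.
Proof.
  apply (continuous_comp (fun x : R * R * R => fst x) (fun x => fst x)).
  - destruct x. apply continuous_fst.
  - destruct x as [[] ]. apply continuous_fst.
Qed.

Lemma smooth_continuous_qt f : smooth f ->
  forall x : R * R * R, continuous (fun x : R * R * R => f (snd (fst x)) (snd x)) x.
Proof.
  intros sf x.
  apply (continuous_comp_2 (fun x : R * R * R => snd (fst x)) (fun x => snd x) f).
  - apply (continuous_comp (fun x : R * R * R => fst x) (fun x => snd x)).
    + destruct x. apply continuous_fst.
    + destruct x as [[] ]. apply continuous_snd.
  - destruct x. apply continuous_snd.
  - apply (smooth_continuous f sf).
Qed.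

Lemma biperiodic_max Tq Tt f : 0 < Tq -> 0 < Tt -> biperiodic Tq Tt f ->
  (forall x, continuous (fun x : R * R * R => f (snd (fst x)) (snd x)) x) ->
  exists q t, forall q' t', f q' t' <= f q t.
Proof.
  intros hTq hTt pf cf.
  destruct (periodic_constrained_max (fun p _ _ => p) (fun _ _ _ => 0) (fun _ _ _ => 0)
    (fun _ q t => f q t) 0 Tq Tt hTq hTt) as [p [q [t [_ Hmax]]]].
  - intros g [<-|[<-|[<-|[<-|[]]]]]; (split; [intros; split|intros x]); trivial.
    + apply continuous_p.
    + apply continuous_const.
    + apply continuous_const.
    + apply pf.
    + apply pf.
  - intros; lra.
  - exists 0, 0, 0. lra.
  - exists q, t. intros q' t'. apply (Hmax 0 q' t' eq_refl (Rle_refl _) (Rle_refl _)).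
Qed.

Lemma biperiodic_bounded Tq Tt f : 0 < Tq -> 0 < Tt -> smooth f ->
  biperiodic Tq Tt f -> exists M, forall q t, Rabs (f q t) <= M.
Proof.
  intros hTq hTt sf pf.
  destruct (biperiodic_max Tq Tt (fun q t => f q t ^ 2) hTq hTt) as [q [t Hmax]].
  - intros q t. now rewrite (proj1 (pf q t)), (proj2 (pf q t)).
  - intros x. now apply continuous_Rpow, smooth_continuous_qt.
  - exists (1 + f q t ^ 2). intros q' t'. specialize (Hmax q' t').
    pose proof (pow2_abs (f q' t')). pose proof (Rabs_pos (f q' t')). nra.
Qed.

(** The constraint set is bounded because nonnegative roots of the cubic are bounded
    in terms of its coefficients. *)
Lemma max_over_roots Tq Tt u v w (l f : R -> R -> R -> R) :
  0 < Tq -> 0 < Tt -> benney Tq Tt u v w ->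
  (forall g, In g (l :: f :: nil) ->
     (forall p q t, g p (q + Tq) t = g p q t /\ g p q (t + Tt) = g p q t) /\
     (forall x : R * R * R,
        continuous (fun x => g (fst (fst x)) (snd (fst x)) (snd x)) x)) ->
  (exists p q t, quartic_p u v p q t = 0 /\ 0 <= p /\ 0 <= l p q t) ->
  exists p q t, (quartic_p u v p q t = 0 /\ 0 <= p /\ 0 <= l p q t) /\
    forall p' q' t', quartic_p u v p' q' t' = 0 -> 0 <= p' -> 0 <= l p' q' t' ->
      f p' q' t' <= f p q t.
Proof.
  intros hTq hTt H Hlf Hex.
  destruct H as [su sv sw pu pv pw _ _ _].
  destruct (biperiodic_bounded Tq Tt u hTq hTt su pu) as [Mu HMu].
  destruct (biperiodic_bounded Tq Tt v hTq hTt sv pv) as [Mv HMv].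
  apply (periodic_constrained_max (quartic_p u v) (fun p _ _ => p) l f
           (1 + 2 * Mu + Mv) Tq Tt); trivial.
  - intros g [<-|[<-|Hg]]; [| |auto]; (split; [intros p q t|intros x]).
    + unfold quartic_p.
      rewrite (proj1 (pu q t)), (proj2 (pu q t)), (proj1 (pv q t)), (proj2 (pv q t)). auto.
    + unfold quartic_p. pose proof (continuous_p x).
      pose proof (smooth_continuous_qt u su x). pose proof (smooth_continuous_qt v sv x).
      continuity_poly.
    + auto.
    + apply continuous_p.
  - intros p q t hc hp _.
    pose proof (cubic_root_bound (u q t) (v q t) p hp hc).
    pose proof (HMu q t). pose proof (HMv q t). lra.
Qed.

Lemma quartic_q_periodic Tq Tt u v w : benney Tq Tt u v w -> forall p q t,
  u (q + Tq) t = u q t /\ u q (t + Tt) = u q t /\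
  quartic_q u v w p (q + Tq) t = quartic_q u v w p q t /\
  quartic_q u v w p q (t + Tt) = quartic_q u v w p q t.
Proof.
  intros [su sv sw pu pv pw _ _ _] p q t. unfold quartic_q.
  pose proof (pu q t) as [-> ->].
  pose proof (biperiodic_dq _ _ _ pu q t) as [-> ->].
  pose proof (biperiodic_dq _ _ _ pv q t) as [-> ->].
  pose proof (biperiodic_dq _ _ _ pw q t) as [-> ->]. auto.
Qed.

Lemma quartic_q_continuous Tq Tt u v w : benney Tq Tt u v w -> forall x : R * R * R,
  continuous (fun x => quartic_q u v w (fst (fst x)) (snd (fst x)) (snd x)) x.
Proof.
  intros [su sv sw _ _ _ _ _ _] x. unfold quartic_q.
  pose proof (continuous_p x).
  pose proof (smooth_continuous_qt _ (smooth_dq u su) x).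
  pose proof (smooth_continuous_qt _ (smooth_dq v sv) x).
  pose proof (smooth_continuous_qt _ (smooth_dq w sw) x).
  continuity_poly.
Qed.

Lemma locally_positive_along Tq Tt u v w q t s r k : benney Tq Tt u v w ->
  r 0 = s -> is_derive r 0 k ->
  (0 < s -> locally 0 (fun y => 0 < r y)) /\
  (0 < beta (u q t) s ->
     locally 0 (fun y => 0 < beta (u (q + s * y) (t + y)) (r y))).
Proof.
  intros H hr Hr. pose proof (is_derive_continuous _ _ _ Hr) as Hcr.
  pose proof (is_derive_continuous _ _ _
    (is_derive_along_line u s q t (benney_su _ _ _ _ _ H))) as Hcu.
  split; intros h.
  - apply (Hcr (fun z => 0 < z)). apply (open_gt 0). now rewrite hr.
  - assert (Hcb : continuous (fun y => beta (u (q + s * y) (t + y)) (r y)) 0).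
    { unfold beta. continuity_poly. }
    apply (Hcb (fun z => 0 < z)). apply (open_gt 0).
    now rewrite hr, Rmult_0_r, !Rplus_0_r.
Qed.

(** By [elliptic_relations] the weight [Y^2 = s^2 beta^3] is stationary, so at a
    maximum of [Y^2 F_q^2 F_pp] the transport equation leaves
    [6 s Y^2 F_q^3 / F_pp = 0]; the weight itself vanishes on the boundary
    [s = 0] or [beta = 0]. *)
Lemma elliptic_quartic_q_zero Tq Tt u v w : 0 < Tq -> 0 < Tt -> benney Tq Tt u v w ->
  forall q t s, 0 < s -> quartic_p u v s q t = 0 -> 0 < beta (u q t) s ->
  quartic_q u v w s q t = 0.
Proof.
  intros hTq hTt H.
  pose (Z (p q t : R) := p ^ 2 * beta (u q t) p ^ 3).
  pose (E p q t := quartic_q u v w p q t ^ 2 * quartic_pp u p q t).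
  pose (f p q t := Z p q t * E p q t).
  assert (Hpp : forall p q t, 0 < p -> 0 < beta (u q t) p -> 0 < quartic_pp u p q t).
  { intros p q t hp hb. unfold quartic_pp, beta in *. nra. }
  assert (Hnp : forall q t s, 0 < s -> quartic_p u v s q t = 0 -> 0 < beta (u q t) s ->
            f s q t <= 0 -> quartic_q u v w s q t = 0).
  { intros q t s hs hc hb hf. pose proof (Hpp s q t hs hb) as hJ.
    assert (hZ : 0 < Z s q t) by (apply Rmult_lt_0_compat; apply pow_lt; assumption).
    assert (hE : E s q t <= 0).
    { apply Rmult_le_reg_l with (Z s q t); [exact hZ|]. rewrite Rmult_0_r. exact hf. }
    unfold E in hE. pose proof (pow2_ge_0 (quartic_q u v w s q t)).
    assert (quartic_q u v w s q t ^ 2 = 0) by nra.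
    apply Rsqr_0_uniq. unfold Rsqr. lra. }
  intros q1 t1 s1 hs1 hc1 hb1.
  destruct (max_over_roots Tq Tt u v w (fun p q t => beta (u q t) p) f hTq hTt H)
    as [s [q [t [[hc [hs hb]] Hmax]]]].
  - intros g [<-|[<-|[]]]; (split; [intros p q t|intros x]).
    + destruct (quartic_q_periodic _ _ _ _ _ H p q t) as [-> [-> _]]. auto.
    + unfold beta. pose proof (continuous_p x).
      pose proof (smooth_continuous_qt u (benney_su _ _ _ _ _ H) x). continuity_poly.
    + unfold f, Z, E, quartic_pp.
      destruct (quartic_q_periodic _ _ _ _ _ H p q t) as [-> [-> [-> ->]]]. auto.
    + unfold f, Z, E, quartic_pp, beta. pose proof (continuous_p x).
      pose proof (quartic_q_continuous _ _ _ _ _ H x).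
      pose proof (smooth_continuous_qt u (benney_su _ _ _ _ _ H) x). continuity_poly.
  - exists s1, q1, t1. repeat split; lra.
  - apply Hnp; trivial.
    apply Rle_trans with (1 := Hmax s1 q1 t1 hc1 (Rlt_le _ _ hs1) (Rlt_le _ _ hb1)).
    destruct (Rle_lt_or_eq_dec _ _ hs) as [hs0|hs0].
    2: { unfold f, Z. rewrite <- hs0. right. ring. }
    destruct (Rle_lt_or_eq_dec _ _ hb) as [hb0|hb0].
    2: { unfold f, Z. rewrite <- hb0. right. ring. }
    pose proof (Hpp s q t hs0 hb0) as hJ.
    destruct (transport_along_root _ _ _ _ _ q t s H hc hJ)
      as [r [hr [Hr [Hroot [HE HZ]]]]].
    assert (hv : v q t < 0).
    { unfold quartic_p in hc. unfold beta in hb0.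
      assert (0 < s * (s ^ 2 + 2 * u q t)) by (apply Rmult_lt_0_compat; nra). lra. }
    destruct (elliptic_relations _ _ _ _ _ hTq hTt H q t s hv hs0 hc hb0) as [e1 e2].
    set (K := quartic_q u v w s q t) in *.
    assert (hK : K = quartic_pp u s q t * dq u q t).
    { unfold K, quartic_q, quartic_pp. rewrite e1, e2. ring. }
    replace (K / quartic_pp u s q t - dq u q t) with 0 in HZ, Hr by (rewrite hK; field; lra).
    rewrite e1 in HZ.
    destruct (locally_positive_along Tq Tt u v w q t s r _ H hr Hr) as [Hpos Hbeta].
    assert (e0 : f (r 0) (q + s * 0) (t + 0) = f s q t)
      by (rewrite hr, Rmult_0_r, !Rplus_0_r; reflexivity).
    assert (Hd : is_derive (fun y => f (r y) (q + s * y) (t + y)) 0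
              (s ^ 2 * beta (u q t) s ^ 3 * (6 * s * K ^ 3 / quartic_pp u s q t))).
    { pose proof (is_derive_mult _ _ _ _ _ HZ HE Rmult_comm) as Hm.
      match type of Hm with is_derive _ _ ?l =>
        match goal with |- is_derive _ _ ?l' => replace l' with l end end; [exact Hm|].
      cbv beta. unfold plus, mult; cbn -[pow]. rewrite hr, !Rmult_0_r, !Rplus_0_r.
      ring. }
    apply is_derive_at_max in Hd.
    + assert (hK0 : K ^ 3 = 0).
      { apply Rmult_eq_reg_l with (s ^ 2 * beta (u q t) s ^ 3 * (6 * s / quartic_pp u s q t)).
        - rewrite Rmult_0_r, <- Hd. unfold Rdiv. ring.
        - apply Rgt_not_eq. repeat apply Rmult_lt_0_compat; try lra;
            try (now apply pow_lt). now apply Rinv_0_lt_compat. }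
      assert (hK1 : K = 0).
      { destruct (Req_dec K 0) as [|h]; trivial. now apply pow_nonzero with (n := 3%nat) in h. }
      right. unfold f, E. fold K. rewrite hK1. ring.
    + generalize (filter_and _ _ (filter_and _ _ Hroot (Hpos hs0)) (Hbeta hb0)).
      apply filter_imp. intros y [[h1 h2] h3].
      rewrite e0. apply Hmax; trivial; lra.
Qed.

(** At a maximum of [F_q^2 F_pp] the transport equation leaves
    [6 s F_q^3 / F_pp = 0]. Maximising over [beta <= 0] loses nothing: a critical
    point that moves into [beta > 0] has [F_q = 0] there, and a positive value
    excludes both [F_pp = 0], where critical points merge, and [s = 0], where
    [beta <= 0] forces [F_pp <= 0]. *)
Lemma quartic_q_zero_positive Tq Tt u v w : 0 < Tq -> 0 < Tt -> benney Tq Tt u v w ->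
  forall q t s, 0 < s -> quartic_p u v s q t = 0 -> 0 < quartic_pp u s q t ->
  quartic_q u v w s q t = 0.
Proof.
  intros hTq hTt H.
  pose (f p q t := quartic_q u v w p q t ^ 2 * quartic_pp u p q t).
  intros q1 t1 s1 hs1 hc1 hJ1.
  destruct (Rlt_dec 0 (beta (u q1 t1) s1)) as [hb1|hb1].
  { now apply (elliptic_quartic_q_zero Tq Tt). }
  assert (Hnp : f s1 q1 t1 <= 0 -> quartic_q u v w s1 q1 t1 = 0).
  { unfold f. intros hf. pose proof (pow2_ge_0 (quartic_q u v w s1 q1 t1)).
    assert (quartic_q u v w s1 q1 t1 ^ 2 = 0) by nra.
    apply Rsqr_0_uniq. unfold Rsqr. lra. }
  apply Hnp.
  destruct (max_over_roots Tq Tt u v w (fun p q t => - beta (u q t) p) f hTq hTt H)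
    as [s [q [t [[hc [hs hb]] Hmax]]]].
  - intros g [<-|[<-|[]]]; (split; [intros p q t|intros x]).
    + destruct (quartic_q_periodic _ _ _ _ _ H p q t) as [-> [-> _]]. auto.
    + unfold beta. pose proof (continuous_p x).
      pose proof (smooth_continuous_qt u (benney_su _ _ _ _ _ H) x). continuity_poly.
    + unfold f, quartic_pp.
      destruct (quartic_q_periodic _ _ _ _ _ H p q t) as [-> [-> [-> ->]]]. auto.
    + unfold f, quartic_pp. pose proof (continuous_p x).
      pose proof (quartic_q_continuous _ _ _ _ _ H x).
      pose proof (smooth_continuous_qt u (benney_su _ _ _ _ _ H) x). continuity_poly.
  - exists s1, q1, t1. repeat split; lra.
  - apply Rle_trans with (1 := Hmax s1 q1 t1 hc1 (Rlt_le _ _ hs1) ltac:(lra)).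
    set (K := quartic_q u v w s q t).
    destruct (Rle_dec (quartic_pp u s q t) 0) as [hJ|hJ].
    { unfold f. pose proof (pow2_ge_0 (quartic_q u v w s q t)). nra. }
    apply Rnot_le_lt in hJ.
    assert (hs0 : 0 < s).
    { destruct (Rle_lt_or_eq_dec _ _ hs) as [|e]; trivial.
      exfalso. rewrite <- e in *. unfold quartic_pp, beta in *. lra. }
    destruct (transport_along_root _ _ _ _ _ q t s H hc hJ)
      as [r [hr [Hr [Hroot [HE _]]]]].
    destruct (locally_positive_along Tq Tt u v w q t s r _ H hr Hr) as [Hpos _].
    assert (hf0 : 0 <= f s q t).
    { unfold f. apply Rmult_le_pos; [apply pow2_ge_0|lra]. }
    apply is_derive_at_max in HE.
    + fold K in HE.
      assert (hK0 : K ^ 3 = 0).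
      { apply Rmult_eq_reg_l with (6 * s / quartic_pp u s q t).
        - rewrite Rmult_0_r, <- HE. unfold Rdiv. ring.
        - apply Rgt_not_eq. apply Rmult_lt_0_compat; [lra|]. now apply Rinv_0_lt_compat. }
      assert (hK1 : K = 0).
      { destruct (Req_dec K 0) as [|h]; trivial. now apply pow_nonzero with (n := 3%nat) in h. }
      right. unfold f. fold K. rewrite hK1. ring.
    + generalize (filter_and _ _ Hroot (Hpos hs0)).
      apply filter_imp. intros y [h1 h2].
      change (f (r y) (q + s * y) (t + y) <= f (r 0) (q + s * 0) (t + 0)).
      rewrite hr, Rmult_0_r, !Rplus_0_r.
      change (f (r y) (q + s * y) (t + y) <= f s q t).
      destruct (Rlt_dec 0 (beta (u (q + s * y) (t + y)) (r y))) as [h3|h3].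
      * replace (f (r y) (q + s * y) (t + y)) with 0; [exact hf0|].
        unfold f. rewrite (elliptic_quartic_q_zero Tq Tt u v w hTq hTt H); trivial. ring.
      * apply Hmax; trivial; lra.
Qed.

(** * Reversal of time *)

Lemma dq_scal_reflect c f : smooth f -> forall q t,
  dq (fun q t => c * f q (- t)) q t = c * dq f q (- t).
Proof.
  intros sf q t. apply is_derive_unique. now apply is_derive_scal_reflect_q.
Qed.

(** [F(p, q, t)] is replaced by [F(-p, q, -t)]. *)
Lemma benney_reversal Tq Tt u v w : benney Tq Tt u v w ->
  benney Tq Tt (fun q t => 1 * u q (- t)) (fun q t => -1 * v q (- t))
    (fun q t => 1 * w q (- t)).
Proof.
  intros [su sv sw pu pv pw Eu Ev Ew].
  assert (Hp : forall c f, biperiodic Tq Tt f -> biperiodic Tq Tt (fun q t => c * f q (- t))).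
  { intros c f pf q t. rewrite (proj1 (pf q (- t))). split; trivial.
    rewrite <- (proj2 (pf q (- (t + Tt)))). do 2 f_equal. ring. }
  assert (Ht : forall c f, smooth f -> forall q t,
            dt (fun q t => c * f q (- t)) q t = - c * dt f q (- t)).
  { intros c f sf q t. apply is_derive_unique. now apply is_derive_scal_reflect_t. }
  split; try (now apply smooth_scal_reflect); try (now apply Hp); intros q t;
    rewrite !Ht, !dq_scal_reflect by assumption.
  - rewrite Eu. ring.
  - rewrite Ev. ring.
  - rewrite Ew. ring.
Qed.

Lemma quartic_q_zero_negative Tq Tt u v w : 0 < Tq -> 0 < Tt -> benney Tq Tt u v w ->
  forall q t s, s < 0 -> quartic_p u v s q t = 0 -> 0 < quartic_pp u s q t ->
  quartic_q u v w s q t = 0.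
Proof.
  intros hTq hTt H q t s hs hc hJ.
  pose proof (quartic_q_zero_positive Tq Tt _ _ _ hTq hTt (benney_reversal _ _ _ _ _ H)
    q (- t) (- s)) as HK.
  destruct H as [su sv sw _ _ _ _ _ _].
  unfold quartic_p, quartic_pp, quartic_q in *.
  rewrite !dq_scal_reflect in HK by assumption. rewrite !Ropp_involutive in HK.
  rewrite <- HK; [ring|lra| |]; nra.
Qed.

(** * Relations in the elliptic and hyperbolic regions *)

(** Minus the discriminant of [p^3 + 2 u p + v]: positive when only one root is
    real. *)
Definition discr (u v : R) : R := 32 * u ^ 3 + 27 * v ^ 2.

(** Here [F_q(s) = F_pp(s) u_q] by [elliptic_relations], so the vanishing of [F_q]
    at the real critical point kills [u_q]. *)
Lemma elliptic_dq_v_zero_neg Tq Tt u v w : 0 < Tq -> 0 < Tt -> benney Tq Tt u v w ->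
  forall q t, v q t < 0 -> 0 < discr (u q t) (v q t) -> dq v q t = 0.
Proof.
  intros hTq hTt H q t hv hD.
  destruct (positive_root_spec (u q t) (v q t) hv) as [hs es].
  set (s := positive_root (u q t) (v q t)) in *.
  pose proof (positive_root_simple _ _ _ hv hs es) as hJ.
  assert (hb : 0 < beta (u q t) s).
  { assert (e : discr (u q t) (v q t) = 4 * beta (u q t) s * (3 * s ^ 2 + 2 * u q t) ^ 2).
    { unfold discr, beta. replace (v q t) with (- (s ^ 3 + 2 * u q t * s)) by lra. field. }
    apply Rmult_lt_reg_r with ((3 * s ^ 2 + 2 * u q t) ^ 2); [now apply pow_lt|]. lra. }
  destruct (elliptic_relations _ _ _ _ _ hTq hTt H q t s hv hs es hb) as [e1 e2].
  pose proof (quartic_q_zero_positive _ _ _ _ _ hTq hTt H q t s hs es hJ) as hK.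
  unfold quartic_q in hK. rewrite e1, e2 in hK.
  assert (h : (3 * s ^ 2 + 2 * u q t) * dq u q t = 0) by lra.
  destruct (Rmult_integral _ _ h) as [h'|h']; [lra|]. rewrite e1, h'. ring.
Qed.

Lemma elliptic_dq_v_zero Tq Tt u v w : 0 < Tq -> 0 < Tt -> benney Tq Tt u v w ->
  forall q t, v q t <> 0 -> 0 < discr (u q t) (v q t) -> dq v q t = 0.
Proof.
  intros hTq hTt H q t hv hD. destruct (Rlt_dec (v q t) 0) as [h|h].
  - now apply (elliptic_dq_v_zero_neg Tq Tt u v w).
  - pose proof (elliptic_dq_v_zero_neg Tq Tt _ _ _ hTq hTt (benney_reversal _ _ _ _ _ H)
      q (- t)) as Hr.
    rewrite dq_scal_reflect in Hr by apply H. cbv beta in Hr.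
    rewrite Ropp_involutive in Hr. unfold discr in *.
    specialize (Hr ltac:(lra)). nra.
Qed.

(** The local minimum of the cubic, at [sqrt (- 2 u / 3)], has a negative value; the
    root is to its right. *)
Lemma cubic_root_right u v : discr u v < 0 ->
  exists s, 0 < s /\ s ^ 3 + 2 * u * s + v = 0 /\ 0 < 3 * s ^ 2 + 2 * u.
Proof.
  unfold discr. intros hD.
  assert (hu : u < 0) by (pose proof (pow2_ge_0 v); nra).
  set (m := sqrt (- 2 * u / 3)).
  assert (hm : 0 < m) by (apply sqrt_lt_R0; lra).
  assert (hmm : m ^ 2 = - 2 * u / 3) by (apply pow2_sqrt; lra).
  assert (hcm : m ^ 3 + 2 * u * m + v < 0).
  { replace (m ^ 3 + 2 * u * m + v) with (v - (- 4 * u / 3) * m)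
      by (replace (m ^ 3) with (m ^ 2 * m) by ring; rewrite hmm; field).
    assert (0 < (- 4 * u / 3) * m) by (apply Rmult_lt_0_compat; lra).
    assert (v ^ 2 < ((- 4 * u / 3) * m) ^ 2).
    { rewrite Rpow_mult_distr, hmm. nra. }
    nra. }
  set (M := 1 + 2 * Rabs u + Rabs v + m).
  pose proof (Rabs_pos u). pose proof (Rabs_pos v).
  pose proof (Rle_abs (- u)). pose proof (Rle_abs (- v)). rewrite Rabs_Ropp in *.
  destruct (IVT (fun p => p ^ 3 + 2 * u * p + v) m M) as [s [Hs Hs0]].
  - apply cubic_continuity.
  - unfold M; lra.
  - exact hcm.
  - assert (hM : 1 <= M) by (unfold M; lra).
    assert (M <= M ^ 2) by nra.
    assert (1 + Rabs v <= M ^ 2 + 2 * u) by (unfold M in *; lra). nra.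
  - exists s. split; [lra|]. split; [exact Hs0|].
    assert (hsm : m < s).
    { destruct (Rle_lt_or_eq_dec _ _ (proj1 Hs)) as [|e]; trivial.
      rewrite e in hcm. lra. }
    nra.
Qed.

(** Three real critical points: the extreme ones have constant critical values,
    so the differentials of [u], [v], [w] are proportional, with the middle
    critical point [r] as ratio. *)
Lemma hyperbolic_relations Tq Tt u v w : 0 < Tq -> 0 < Tt -> benney Tq Tt u v w ->
  forall q t, discr (u q t) (v q t) < 0 -> exists r,
    quartic_p u v r q t = 0 /\ quartic_pp u r q t < 0 /\
    dq v q t = r * dq u q t /\ dt v q t = r * dt u q t.
Proof.
  intros hTq hTt H q t hD.
  destruct (cubic_root_right _ _ hD) as [s [hs [es Js]]].
  destruct (cubic_root_right (u q t) (- v q t)) as [s' [hs' [es' Js']]].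
  { unfold discr in *. nra. }
  pose proof (quartic_q_zero_positive _ _ _ _ _ hTq hTt H q t s hs es Js) as K1.
  assert (K2 : quartic_q u v w (- s') q t = 0).
  { apply (quartic_q_zero_negative Tq Tt); unfold quartic_p, quartic_pp; trivial; try lra; nra. }
  unfold quartic_q in K1, K2. exists (s' - s). unfold quartic_p, quartic_pp.
  assert (hsum : s ^ 2 - s * s' + s' ^ 2 + 2 * u q t = 0).
  { apply Rmult_eq_reg_l with (s + s'); [|lra]. rewrite Rmult_0_r. nra. }
  assert (hv : v q t = - s * s' * (s - s')).
  { replace (2 * u q t) with (- (s ^ 2 - s * s' + s' ^ 2)) in es by lra. nra. }
  assert (hu : 2 * u q t = - (s ^ 2 - s * s' + s' ^ 2)) by lra.
  assert (J1 : 0 < (s + s') * (2 * s - s')) by nra.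
  assert (J2 : 0 < (s + s') * (2 * s' - s)) by nra.
  assert (j1 : 0 < 2 * s - s') by (apply Rmult_lt_reg_l with (s + s'); lra).
  assert (j2 : 0 < 2 * s' - s) by (apply Rmult_lt_reg_l with (s + s'); lra).
  assert (e1 : dq v q t = (s' - s) * dq u q t).
  { apply Rmult_eq_reg_l with (s + s'); [|lra]. nra. }
  split; [rewrite hv, hu; ring|]. split; [nra|]. split; [exact e1|].
  rewrite (benney_u _ _ _ _ _ H), (benney_v _ _ _ _ _ H), e1, hu.
  assert (e2 : dq w q t = - (dq u q t * s ^ 2 + dq v q t * s)) by lra.
  rewrite e2, e1. ring.
Qed.

(** * [v] does not depend on [q] *)

Lemma is_derive_locally_zero (f : R -> R) x l :
  is_derive f x l -> locally x (fun y => f y = 0) -> l = 0.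
Proof.
  intros Hf H0. apply (is_derive_at_max f x); trivial.
  pose proof (locally_singleton _ _ H0) as hx. revert H0. apply filter_imp.
  intros y hy. lra.
Qed.

(** Algebra at a critical point of [(discr v_q)^2], with [b = u_q]. Both [u] and [v]
    are constant to first order in the direction [dq/dt = r], so the two stationarity
    conditions give [v_qt = - r v_qq]; the last hypothesis is the [t]-derivative of
    [v_q^3 + 2 u v_q u_q^2 + v u_q^3 = 0], and then reduces to [r^2 u_q^4 = 0]. *)
Lemma hyperbolic_second_order b vqq vqt u r :
  let v := - (r ^ 3 + 2 * u * r) in
  let D := discr u v in
  let vq := r * b in let ut := - vq in let vt := r * ut in let uqt := - vqq in
  3 * r ^ 2 + 2 * u < 0 -> D <> 0 ->
  (96 * u ^ 2 * b + 54 * v * vq) * vq + D * vqq = 0 ->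
  (96 * u ^ 2 * ut + 54 * v * vt) * vq + D * vqt = 0 ->
  3 * vq ^ 2 * vqt + 2 * (ut * vq * b ^ 2 + u * (vqt * b ^ 2 + 2 * vq * b * uqt))
    + vt * b ^ 3 + 3 * v * b ^ 2 * uqt = 0 ->
  vq = 0.
Proof.
  intros v D vq ut vt uqt hJ hD Dq Dt Et.
  destruct (Req_dec b 0) as [hb|hb]; [unfold vq; rewrite hb; ring|].
  destruct (Req_dec r 0) as [hr|hr]; [unfold vq; rewrite hr; ring|].
  exfalso.
  assert (h1 : vqt = - r * vqq).
  { apply Rmult_eq_reg_l with D; [|exact hD].
    assert (h : D * vqt + r * (D * vqq) = 0).
    { replace (D * vqq) with (- (96 * u ^ 2 * b + 54 * v * vq) * vq) by lra.
      replace (D * vqt) with (- (96 * u ^ 2 * ut + 54 * v * vt) * vq) by lra.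
      unfold vt, ut, vq. ring. }
    lra. }
  set (J := 3 * r ^ 2 + 2 * u) in *.
  assert (hEt : b ^ 2 * (J * vqt + r * J * vqq - 3 * r ^ 2 * b ^ 2) = 0).
  { rewrite <- Et. unfold uqt, vt, ut, vq, v, J. ring. }
  rewrite h1 in hEt.
  assert (h2 : b ^ 2 * (- 3 * r ^ 2 * b ^ 2) = 0) by lra.
  assert (h3 : 0 < r ^ 2) by (apply pow2_gt_0; exact hr).
  assert (h4 : 0 < b ^ 2) by (apply pow2_gt_0; exact hb).
  assert (0 < b ^ 2 * (3 * r ^ 2 * b ^ 2)) by (apply Rmult_lt_0_compat; nra).
  lra.
Qed.

Lemma is_derive_discr (a b : R -> R) x a' b' : is_derive a x a' -> is_derive b x b' ->
  is_derive (fun y => discr (a y) (b y)) x (96 * a x ^ 2 * a' + 54 * b x * b').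
Proof. intros. unfold discr. derive_by_hyps. ring. Qed.

Lemma is_derive_discr_mult (a b c : R -> R) x a' b' c' :
  is_derive a x a' -> is_derive b x b' -> is_derive c x c' ->
  is_derive (fun y => (discr (a y) (b y) * c y) ^ 2) x
    (2 * (discr (a x) (b x) * c x)
     * ((96 * a x ^ 2 * a' + 54 * b x * b') * c x + discr (a x) (b x) * c')).
Proof. intros. unfold discr. derive_by_hyps. ring. Qed.

Lemma is_derive_homogeneous_cubic (a b c d : R -> R) x a' b' c' d' :
  is_derive a x a' -> is_derive b x b' -> is_derive c x c' -> is_derive d x d' ->
  is_derive (fun y => d y ^ 3 + 2 * a y * d y * c y ^ 2 + b y * c y ^ 3) x
    (3 * d x ^ 2 * d'
     + 2 * (a' * d x * c x ^ 2 + a x * (d' * c x ^ 2 + 2 * d x * c x * c'))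
     + b' * c x ^ 3 + 3 * b x * c x ^ 2 * c').
Proof. intros. derive_by_hyps. ring. Qed.

Lemma is_derive_locally (f : R -> R) x l (P : R -> Prop) :
  is_derive f x l -> open P -> P (f x) -> locally x (fun y => P (f y)).
Proof. intros Hf HP Hx. exact (is_derive_continuous _ _ _ Hf P (HP _ Hx)). Qed.

(** The factor [discr] removes the degenerate set, on which the middle critical
    point is not a smooth function. *)
Lemma discr_dq_v_zero Tq Tt u v w : 0 < Tq -> 0 < Tt -> benney Tq Tt u v w ->
  forall q t, discr (u q t) (v q t) * dq v q t = 0.
Proof.
  intros hTq hTt H.
  pose proof (benney_su _ _ _ _ _ H) as su. pose proof (benney_sv _ _ _ _ _ H) as sv.
  pose (f q t := (discr (u q t) (v q t) * dq v q t) ^ 2).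
  destruct (biperiodic_max Tq Tt f hTq hTt) as [q [t Hmax]].
  { intros q t. unfold f.
    pose proof (benney_pu _ _ _ _ _ H q t) as [-> ->].
    pose proof (biperiodic_dq _ _ _ (benney_pv _ _ _ _ _ H) q t) as [-> ->].
    pose proof (benney_pv _ _ _ _ _ H q t) as [-> ->]. auto. }
  { intros x. unfold f, discr.
    pose proof (smooth_continuous_qt _ su x). pose proof (smooth_continuous_qt _ sv x).
    pose proof (smooth_continuous_qt _ (smooth_dq v sv) x). continuity_poly. }
  assert (H0 : discr (u q t) (v q t) * dq v q t = 0).
  2: { intros q' t'. specialize (Hmax q' t'). unfold f in Hmax. rewrite H0 in Hmax.
       pose proof (pow2_ge_0 (discr (u q' t') (v q' t') * dq v q' t')).
       apply Rsqr_0_uniq. unfold Rsqr. lra. }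
  destruct (Req_dec (dq v q t) 0) as [hvq|hvq]; [rewrite hvq; ring|].
  destruct (Rtotal_order (discr (u q t) (v q t)) 0) as [hD|[hD|hD]];
    [|rewrite hD; ring|]; exfalso; apply hvq.
  - destruct (hyperbolic_relations _ _ _ _ _ hTq hTt H q t hD) as [r [hc [hJ [e1 e2]]]].
    pose proof (smooth_is_derive_q u su q t) as uq.
    pose proof (smooth_is_derive_q v sv q t) as vq.
    pose proof (smooth_is_derive_q _ (smooth_dq v sv) q t) as vqq.
    pose proof (smooth_is_derive_t u su q t) as ut.
    pose proof (smooth_is_derive_t v sv q t) as vt.
    pose proof (smooth_is_derive_t _ (smooth_dq v sv) q t) as vqt.
    pose proof (smooth_is_derive_t _ (smooth_dq u su) q t) as uqt.
    assert (hne : 2 * (discr (u q t) (v q t) * dq v q t) <> 0).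
    { repeat apply Rmult_integral_contrapositive_currified; lra. }
    pose proof (is_derive_at_max _ _ _ (is_derive_discr_mult _ _ _ _ _ _ _ uq vq vqq)
      (filter_forall _ (fun y => Hmax y t))) as Dq.
    pose proof (is_derive_at_max _ _ _ (is_derive_discr_mult _ _ _ _ _ _ _ ut vt vqt)
      (filter_forall _ (fun y => Hmax q y))) as Dt.
    apply Rmult_integral in Dq. apply Rmult_integral in Dt.
    destruct Dq as [Dq|Dq]; [contradiction|]. destruct Dt as [Dt|Dt]; [contradiction|].
    (* Eliminating r from r^3 + 2 u r + v = 0 and v_q = r u_q leaves an identity
       between smooth functions that can be differentiated. *)
    pose proof (is_derive_homogeneous_cubic _ _ _ _ _ _ _ _ _ ut vt uqt vqt) as Ht.
    apply is_derive_locally_zero in Ht.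
    + rewrite (benney_dq_u _ _ _ _ _ H) in Ht.
      rewrite e2, (benney_u _ _ _ _ _ H) in Ht, Dt.
      assert (hv : v q t = - (r ^ 3 + 2 * u q t * r)) by (unfold quartic_p in hc; lra).
      rewrite e1 in *. rewrite hv in *.
      apply (hyperbolic_second_order (dq u q t) (dq (dq v) q t) (dt (dq v) q t) (u q t) r);
        trivial. lra.
    + generalize (is_derive_locally _ _ _ _ (is_derive_discr _ _ _ _ _ ut vt)
        (open_lt 0) hD).
      apply filter_imp. intros y hy.
      destruct (hyperbolic_relations _ _ _ _ _ hTq hTt H q y hy) as [r' [hc' [_ [e1' _]]]].
      rewrite e1'. replace (v q y) with (- (r' ^ 3 + 2 * u q y * r'))
        by (unfold quartic_p in hc'; lra). ring.
  - (* If v_q were nonzero here, v would have to vanish on a whole interval. *)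
    pose proof (smooth_is_derive_q u su q t) as uq.
    pose proof (smooth_is_derive_q v sv q t) as vq.
    pose proof (smooth_is_derive_q _ (smooth_dq v sv) q t) as vqq.
    apply (is_derive_locally_zero _ _ _ vq).
    generalize (filter_and _ _
      (is_derive_locally _ _ _ _ (is_derive_discr _ _ _ _ _ uq vq) (open_gt 0) hD)
      (is_derive_locally _ _ _ _ vqq (open_neq 0) hvq)).
    apply filter_imp. intros y [h1 h2].
    destruct (Req_dec (v y t) 0) as [|hv]; trivial.
    exfalso. apply h2. now apply (elliptic_dq_v_zero Tq Tt u v w).
Qed.

(** Algebra at a maximum of [v_q^2] where [discr u v] vanishes identically nearby,
    so that its first and second derivatives are available. *)
Lemma degenerate_second_order u v uq vq uqq ut vt :
  ut = - vq ->
  16 * u ^ 2 * uq + 9 * v * vq = 0 -> 16 * u ^ 2 * ut + 9 * v * vt = 0 ->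
  32 * u * uq * uq + 16 * u ^ 2 * uqq + 9 * vq * vq = 0 ->
  32 * u * ut * uq + 9 * vt * vq = 0 ->
  32 * u ^ 3 + 27 * v ^ 2 = 0 -> vq = 0.
Proof.
  intros -> e1 e2 e3 e4 hD.
  destruct (Req_dec vq 0) as [|hvq]; trivial. exfalso.
  assert (hvt : 9 * vt = 32 * u * uq).
  { apply Rmult_eq_reg_r with vq; [|exact hvq]. lra. }
  destruct (Req_dec u 0) as [hu|hu].
  { rewrite hu in e3. nra. }
  assert (h1 : u * vq = 2 * uq * v).
  { apply Rmult_eq_reg_l with (16 * u); [|lra]. nra. }
  assert (h2 : vq * (16 * u ^ 3 + 18 * v ^ 2) = 0).
  { replace (vq * (16 * u ^ 3 + 18 * v ^ 2))
      with (16 * u ^ 2 * (u * vq) + 18 * v ^ 2 * vq) by ring.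
    rewrite h1.
    replace (16 * u ^ 2 * (2 * uq * v) + 18 * v ^ 2 * vq)
      with (2 * v * (16 * u ^ 2 * uq + 9 * v * vq)) by ring.
    rewrite e1. ring. }
  destruct (Rmult_integral _ _ h2) as [|h3]; [contradiction|].
  assert (hv : v ^ 2 = 0) by lra.
  assert (hu3 : u ^ 3 = 0) by lra.
  now apply (pow_nonzero u 3) in hu3.
Qed.

Lemma dq_v_zero Tq Tt u v w : 0 < Tq -> 0 < Tt -> benney Tq Tt u v w ->
  forall q t, dq v q t = 0.
Proof.
  intros hTq hTt H.
  pose proof (benney_su _ _ _ _ _ H) as su. pose proof (benney_sv _ _ _ _ _ H) as sv.
  assert (HD : forall q t, dq v q t <> 0 -> discr (u q t) (v q t) = 0).
  { intros q t h. destruct (Rmult_integral _ _ (discr_dq_v_zero _ _ _ _ _ hTq hTt H q t));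
      [assumption|contradiction]. }
  assert (Hnq : forall q t, dq v q t <> 0 -> locally q (fun y => dq v y t <> 0)).
  { intros q t h. exact (is_derive_locally _ _ _ _
      (smooth_is_derive_q _ (smooth_dq v sv) q t) (open_neq 0) h). }
  assert (Hnt : forall q t, dq v q t <> 0 -> locally t (fun y => dq v q y <> 0)).
  { intros q t h. exact (is_derive_locally _ _ _ _
      (smooth_is_derive_t _ (smooth_dq v sv) q t) (open_neq 0) h). }
  assert (HDq : forall q t, dq v q t <> 0 ->
            16 * u q t ^ 2 * dq u q t + 9 * v q t * dq v q t = 0).
  { intros q t h. pose proof (is_derive_discr _ _ _ _ _
      (smooth_is_derive_q u su q t) (smooth_is_derive_q v sv q t)) as Hd.
    apply is_derive_locally_zero in Hd; [lra|].
    generalize (Hnq q t h). apply filter_imp. intros y hy. now apply HD. }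
  assert (HDt : forall q t, dq v q t <> 0 ->
            16 * u q t ^ 2 * dt u q t + 9 * v q t * dt v q t = 0).
  { intros q t h. pose proof (is_derive_discr _ _ _ _ _
      (smooth_is_derive_t u su q t) (smooth_is_derive_t v sv q t)) as Hd.
    apply is_derive_locally_zero in Hd; [lra|].
    generalize (Hnt q t h). apply filter_imp. intros y hy. now apply HD. }
  pose (f q t := dq v q t ^ 2).
  destruct (biperiodic_max Tq Tt f hTq hTt) as [q [t Hmax]].
  { intros q t. unfold f.
    pose proof (biperiodic_dq _ _ _ (benney_pv _ _ _ _ _ H) q t) as [-> ->]. auto. }
  { intros x. unfold f.
    pose proof (smooth_continuous_qt _ (smooth_dq v sv) x). continuity_poly. }
  assert (H0 : dq v q t = 0).
  2: { intros q' t'. specialize (Hmax q' t'). unfold f in Hmax. rewrite H0 in Hmax.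
       pose proof (pow2_ge_0 (dq v q' t')). apply Rsqr_0_uniq. unfold Rsqr. lra. }
  destruct (Req_dec (dq v q t) 0) as [|hvq]; trivial.
  pose proof (smooth_is_derive_q _ (smooth_dq v sv) q t) as vqq.
  pose proof (smooth_is_derive_t _ (smooth_dq v sv) q t) as vqt.
  assert (Hsq : forall (g : R -> R) x l, is_derive g x l -> g x <> 0 ->
            locally x (fun y => g y ^ 2 <= g x ^ 2) -> l = 0).
  { intros g x l Hg hg Hm.
    assert (Hd : is_derive (fun y => g y ^ 2) x (2 * g x * l)) by (derive_by_hyps; ring).
    apply is_derive_at_max in Hd; [|exact Hm].
    destruct (Rmult_integral _ _ Hd); lra. }
  assert (hvqq : dq (dq v) q t = 0).
  { apply (Hsq _ _ _ vqq hvq). apply filter_forall. intros y. apply (Hmax y t). }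
  assert (hvqt : dt (dq v) q t = 0).
  { apply (Hsq _ _ _ vqt hvq). apply filter_forall. intros y. apply (Hmax q y). }
  assert (Hprod : forall (a b c d : R -> R) x a' b' c' d', is_derive a x a' ->
    is_derive b x b' -> is_derive c x c' -> is_derive d x d' ->
    is_derive (fun y => 16 * a y ^ 2 * c y + 9 * b y * d y) x
      (32 * a x * a' * c x + 16 * a x ^ 2 * c' + 9 * b' * d x + 9 * b x * d')).
  { intros. derive_by_hyps. ring. }
  pose proof (Hprod _ _ _ _ _ _ _ _ _ (smooth_is_derive_q u su q t)
    (smooth_is_derive_q v sv q t) (smooth_is_derive_q _ (smooth_dq u su) q t) vqq) as Gq.
  apply is_derive_locally_zero in Gq.
  2: { generalize (Hnq q t hvq). apply filter_imp. intros y. apply HDq. }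
  pose proof (Hprod _ _ _ _ _ _ _ _ _ (smooth_is_derive_t u su q t)
    (smooth_is_derive_t v sv q t) (smooth_is_derive_t _ (smooth_dq u su) q t) vqt) as Gt.
  apply is_derive_locally_zero in Gt.
  2: { generalize (Hnt q t hvq). apply filter_imp. intros y. apply HDq. }
  rewrite (benney_dq_u _ _ _ _ _ H), hvqt, hvqq in Gt. rewrite hvqq in Gq.
  apply (degenerate_second_order (u q t) (v q t) (dq u q t) _ (dq (dq u) q t)
           (dt u q t) (dt v q t)).
  - apply (benney_u _ _ _ _ _ H).
  - now apply HDq.
  - now apply HDt.
  - lra.
  - lra.
  - apply (HD q t hvq).
Qed.

(** * The integral as a function of the energy *)

Lemma quartic_integral_benney Tq Tt u v w : smooth u -> smooth v -> smooth w ->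
  biperiodic Tq Tt u -> biperiodic Tq Tt v -> biperiodic Tq Tt w ->
  integral_of_motion u (quartic u v w) -> benney Tq Tt u v w.
Proof.
  intros su sv sw pu pv pw hF.
  assert (E : forall p q t,
    dt u q t * p ^ 2 + dt v q t * p + dt w q t
    + p * (dq u q t * p ^ 2 + dq v q t * p + dq w q t)
    - dq u q t * (p ^ 3 + 2 * u q t * p + v q t) = 0).
  { intros p q t. rewrite <- (hF p q t). unfold d_t, d_q, d_p.
    pose proof (smooth_is_derive_q u su q t). pose proof (smooth_is_derive_q v sv q t).
    pose proof (smooth_is_derive_q w sw q t). pose proof (smooth_is_derive_t u su q t).
    pose proof (smooth_is_derive_t v sv q t). pose proof (smooth_is_derive_t w sw q t).
    change (Derive (fun x => u x t) q) with (dq u q t).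
    f_equal; [f_equal|f_equal].
    - symmetry. apply is_derive_unique. unfold quartic. derive_by_hyps. ring.
    - f_equal. symmetry. apply is_derive_unique. unfold quartic. derive_by_hyps. ring.
    - f_equal. symmetry. apply is_derive_unique. unfold quartic. auto_derive; trivial. field. }
  split; trivial; intros q t; pose proof (E 0 q t); pose proof (E 1 q t);
    pose proof (E (-1) q t); lra.
Qed.

Lemma is_derive_zero_const (f : R -> R) : (forall x, is_derive f x 0) ->
  forall x y, f x = f y.
Proof.
  intros Hf x y.
  destruct (MVT_gen f x y (fun _ => 0)) as [c [_ Hc]].
  - intros; apply Hf.
  - intros z _. apply continuity_pt_filterlim, (is_derive_continuous f z 0), Hf.
  - lra.
Qed.

Lemma periodic_const_derive (f : R -> R) T c : 0 < T -> (forall x, f (x + T) = f x) ->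
  (forall x, is_derive f x c) -> c = 0.
Proof.
  intros hT pf Hf.
  destruct (MVT_gen f 0 (0 + T) (fun _ => c)) as [z [_ Hc]].
  - intros; apply Hf.
  - intros z _. apply continuity_pt_filterlim, (is_derive_continuous f z c), Hf.
  - rewrite pf in Hc. nra.
Qed.

Lemma benney_steady Tq Tt u v w : 0 < Tq -> 0 < Tt -> benney Tq Tt u v w ->
  (forall q t, dt u q t = 0) /\
  exists c d, (forall q t, v q t = c) /\ (forall q t, w q t = u q t ^ 2 + d) /\
    (c <> 0 -> forall q t, u q t = u 0 0).
Proof.
  intros hTq hTt H. pose proof (dq_v_zero _ _ _ _ _ hTq hTt H) as Hvq.
  pose proof (benney_su _ _ _ _ _ H) as su. pose proof (benney_sv _ _ _ _ _ H) as sv.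
  pose proof (benney_sw _ _ _ _ _ H) as sw.
  assert (Hut : forall q t, dt u q t = 0).
  { intros q t. rewrite (benney_u _ _ _ _ _ H), Hvq. ring. }
  assert (Hv0 : forall q t, v q t = v 0 t).
  { intros q t. apply (is_derive_zero_const (fun x => v x t)).
    intros x. rewrite <- (Hvq x t). now apply smooth_is_derive_q. }
  assert (Hvt0 : forall q t, dt v q t = dt v 0 t).
  { intros q t. unfold dt. apply Derive_ext. intros x. apply Hv0. }
  pose (z q t := w q t - u q t ^ 2).
  assert (Hzq : forall q t, is_derive (fun x => z x t) q (- dt v q t)).
  { intros q t. pose proof (smooth_is_derive_q u su q t).
    pose proof (smooth_is_derive_q w sw q t).
    unfold z. derive_by_hyps. rewrite (benney_v _ _ _ _ _ H). ring. }
  assert (Hzt : forall q t, is_derive (fun x => z q x) t (dq u q t * v q t)).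
  { intros q t. pose proof (smooth_is_derive_t u su q t).
    pose proof (smooth_is_derive_t w sw q t).
    unfold z. derive_by_hyps. rewrite (benney_w _ _ _ _ _ H), Hut. ring. }
  assert (Hvt : forall q t, dt v q t = 0).
  { intros q t. rewrite Hvt0.
    assert (h : - dt v 0 t = 0).
    { apply (periodic_const_derive (fun x => z x t) Tq); trivial.
      - intros x. unfold z.
        now rewrite (proj1 (benney_pu _ _ _ _ _ H x t)), (proj1 (benney_pw _ _ _ _ _ H x t)).
      - intros x. rewrite <- (Hvt0 x t). apply Hzq. }
    lra. }
  assert (Hv : forall q t, v q t = v 0 0).
  { intros q t. rewrite Hv0. apply (is_derive_zero_const (fun x => v 0 x)).
    intros x. pose proof (smooth_is_derive_t v sv 0 x) as Hd.
    rewrite Hvt in Hd. exact Hd. }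
  assert (Hz0 : forall q t, z q t = z 0 t).
  { intros q t. apply (is_derive_zero_const (fun x => z x t)).
    intros x. replace 0 with (- dt v x t) by (rewrite Hvt; ring). apply Hzq. }
  assert (Huv : forall q t, dq u q t * v 0 0 = dq u 0 t * v 0 0).
  { intros q t. rewrite <- (Hv q t) at 1. rewrite <- (Hv 0 t) at 1.
    rewrite <- (is_derive_unique _ _ _ (Hzt q t)), <- (is_derive_unique _ _ _ (Hzt 0 t)).
    apply Derive_ext. intros x. apply Hz0. }
  assert (Huq : v 0 0 <> 0 -> forall q t, dq u q t = 0).
  { intros hc.
    assert (He : forall q t, dq u q t = dq u 0 t)
      by (intros q t; exact (Rmult_eq_reg_r _ _ _ (Huv q t) hc)).
    intros q t. rewrite He.
    apply (periodic_const_derive (fun x => u x t) Tq); trivial.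
    - intros x. apply (benney_pu _ _ _ _ _ H).
    - intros x. rewrite <- (He x t). now apply smooth_is_derive_q. }
  split; [exact Hut|]. exists (v 0 0), (z 0 0). split; [exact Hv|]. split.
  - assert (Hz : forall q t, z q t = z 0 0).
    { intros q t. rewrite Hz0. apply (is_derive_zero_const (fun x => z 0 x)).
      intros x. pose proof (Hzt 0 x) as Hd.
      replace (dq u 0 x * v 0 x) with 0 in Hd; [exact Hd|].
      destruct (Req_dec (v 0 0) 0) as [h|h].
      - rewrite Hv, h. ring.
      - rewrite (Huq h). ring. }
    intros q t. rewrite <- (Hz q t). unfold z. ring.
  - intros hc q t. transitivity (u 0 t).
    + apply (is_derive_zero_const (fun x => u x t)). intros x.
      rewrite <- (Huq hc x t). now apply smooth_is_derive_q.
    + apply (is_derive_zero_const (fun x => u 0 x)). intros x.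
      pose proof (smooth_is_derive_t u su 0 x) as Hd. rewrite Hut in Hd. exact Hd.
Qed.

Lemma energy_derivatives u : smooth u -> forall p q t,
  d_p (energy u) p q t = p /\ d_q (energy u) p q t = dq u q t /\
  d_t (energy u) p q t = dt u q t.
Proof.
  intros su p q t.
  pose proof (smooth_is_derive_q u su q t). pose proof (smooth_is_derive_t u su q t).
  unfold d_p, d_q, d_t, energy.
  repeat split; apply is_derive_unique.
  - auto_derive; trivial. field.
  - derive_by_hyps. ring.
  - derive_by_hyps. ring.
Qed.

(** At a regular point of [H = p^2/2 + U] the momentum is nonzero, so its sign is
    locally constant and [p] is a function of [H]. *)
Lemma constant_potential_locally_function u v w U c d :
  smooth u -> (forall q t, u q t = U) -> (forall q t, v q t = c) ->
  (forall q t, w q t = u q t ^ 2 + d) ->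
  locally_function_of (energy u) (quartic u v w).
Proof.
  intros su Hu Hv Hw p q t hreg.
  assert (hp : p <> 0).
  { destruct (energy_derivatives u su p q t) as [e1 [e2 e3]].
    unfold regular_point in hreg. rewrite e1, e2, e3 in hreg.
    assert (hq : dq u q t = 0).
    { apply is_derive_unique. apply is_derive_ext with (f := fun _ => U).
      - intros x. now rewrite Hu.
      - auto_derive; trivial. }
    assert (ht : dt u q t = 0).
    { apply is_derive_unique. apply is_derive_ext with (f := fun _ => U).
      - intros x. now rewrite Hu.
      - auto_derive; trivial. }
    tauto. }
  exists (fun x => x ^ 2 + c * (sign p * sqrt (2 * (x - U))) + d).
  assert (Hnear : locally (p, q, t) (fun x : R * R * R => 0 < sign p * fst (fst x))).
  { assert (Hc : continuous (fun x : R * R * R => sign p * fst (fst x)) (p, q, t)).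
    { pose proof (continuous_p (p, q, t)). continuity_poly. }
    apply (Hc (fun z => 0 < z)). apply (open_gt 0). simpl.
    destruct (Rtotal_order p 0) as [h|[h|h]]; [|contradiction|].
    - rewrite sign_eq_m1 by exact h. lra.
    - rewrite sign_eq_1 by exact h. lra. }
  revert Hnear. apply filter_imp. intros [[p' q'] t'] h. simpl in *.
  unfold quartic, energy. rewrite Hw, Hv, !Hu.
  replace (2 * (p' ^ 2 / 2 + U - U)) with ((sign p * p') ^ 2).
  - rewrite sqrt_pow2 by lra.
    replace (sign p * (sign p * p')) with p'; [field|].
    destruct (Rtotal_order p 0) as [hs|[hs|hs]]; [|contradiction|];
      [rewrite sign_eq_m1 by exact hs|rewrite sign_eq_1 by exact hs]; ring.
  - destruct (Rtotal_order p 0) as [hs|[hs|hs]]; [|contradiction|];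
      [rewrite sign_eq_m1 by exact hs|rewrite sign_eq_1 by exact hs]; field.
Qed.

Theorem corollary1p2 (Tq Tt : R) (hTq : 0 < Tq) (hTt : 0 < Tt)
  (u1 u2 u3 : R -> R -> R)
  (su1 : smooth u1) (su2 : smooth u2) (su3 : smooth u3)
  (pu1 : biperiodic Tq Tt u1) (pu2 : biperiodic Tq Tt u2)
  (pu3 : biperiodic Tq Tt u3)
  (hF : integral_of_motion u1 (quartic u1 u2 u3)) :
  integral_of_motion u1 (energy u1)
  /\ depends_on_energy u1 (quartic u1 u2 u3).
Proof.
  pose proof (quartic_integral_benney Tq Tt u1 u2 u3 su1 su2 su3 pu1 pu2 pu3 hF) as H.
  destruct (benney_steady _ _ _ _ _ hTq hTt H) as [Hut [c [d [Hv [Hw Hc]]]]].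
  split.
  - intros p q t. destruct (energy_derivatives u1 su1 p q t) as [-> [-> ->]].
    rewrite Hut. change (Derive (fun x => u1 x t) q) with (dq u1 q t). ring.
  - destruct (Req_dec c 0) as [hc|hc].
    + assert (Hf : forall p q t, quartic u1 u2 u3 p q t = energy u1 p q t ^ 2 + d).
      { intros p q t. unfold quartic, energy. rewrite Hw, Hv, hc. field. }
      split.
      * intros p q t _. exists (fun x => x ^ 2 + d). apply filter_forall.
        intros x. apply Hf.
      * intros _. exists (fun x => x ^ 2 + d). exact Hf.
    + specialize (Hc hc). split.
      * now apply constant_potential_locally_function with (u1 0 0) c d.
      * intros [q [t [q' [t' hne]]]]. exfalso. apply hne.
        now rewrite (Hc q t), (Hc q' t').
Qed.
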